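(* Suppose that a finite simple graph $G$ is either a chordal graph or a ring graph. Then $I_{\mathcal{Q}_G}$ has a squarefree quadratic initial ideal, i.e., there exists a monomial order with respect to which the initial ideal of $I_{\mathcal{Q}_G}$ is generated by squarefree quadratic monomials.
   Context: A simple graph is chordal if any induced cycle of it is of length 3. A ring graph is a graph each of whose blocks which is not a bridge (cut edge) or a vertex can be constructed from a cycle by successively adding cycles of length $\geq 3$ using the edge sum construction (the edge sum being the gluing of two graphs along a common edge). $G$ is a graph on $[n]=\{1,\dots,n\}$. A subset $W\subset[n]$ is stable if no two distinct elements of $W$ form an edge of $G$ (the empty set and singletons are stable). With $\rho(W)=\sum_{j\in W}\mathbf{e}_j$, the stable set polytope $\mathcal{Q}_G\subset\mathbb{R}^n$ is the convex hull of the $\rho(W)$ for $W$ stable in $G$. Let $K$ be a field. For an integral convex polytope $\mathcal{P}\subset\mathbb{R}^n$ with $\mathcal{P}\cap\mathbb{Z}^n=\{\mathbf{a}_1,\dots,\mathbf{a}_m\}$, the toric ideal $I_{\mathcal{P}}$ is the kernel of the $K$-algebra homomorphism $K[y_1,\dots,y_m]\to K[x_1^{\pm1},\dots,x_n^{\pm1},t]$, $y_i\mapsto X^{\mathbf{a}_i}t$ (where $X^{\mathbf{a}}=x_1^{a_1}\cdots x_n^{a_n}$). *)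

(* Defs.v *)
From HB Require Import structures.
From mathcomp Require Import all_boot all_order all_algebra.
From mathcomp Require Import fraction.
From mathcomp Require Export reals.
From mathcomp Require Export mpoly.

Set Implicit Arguments.
Unset Strict Implicit.
Unset Printing Implicit Defensive.

Import Order.TTheory GRing.Theory Num.Theory.

Local Open Scope ring_scope.

(* Finite simple graphs.  The vertex set is a subset of an ambient finite type,
   so that the subgraphs of a graph (cycles, blocks) are again of type
   [graph V]; an edge is a two-element set of vertices. *)

Record graph (V : finType) := Graph {
  gverts : {set V};
  gedges : {set {set V}};
  gedgesP : gedges \subset [set f in powerset gverts | #|f| == 2%N]
}.

Section Graphs.
Context {V : finType}.
Implicit Types G H C B : graph V.

Definition adj G : rel V := [rel x y | [set x; y] \in gedges G].

Definition subgraph H G : bool :=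
  (gverts H \subset gverts G) && (gedges H \subset gedges G).

Definition induced_subgraph H G : Prop :=
  gverts H \subset gverts G /\
  gedges H = [set f in gedges G | f \subset gverts H].

(* [next s x] is the successor of [x] in the cyclic order given by [s]. *)
Definition is_cycle C : Prop :=
  exists s : seq V,
    [/\ (2 < size s)%N, uniq s, gverts C = [set x in s]
      & gedges C = [set [set x; next s x] | x in s]].

Definition chordal G : Prop :=
  forall C, is_cycle C -> induced_subgraph C G -> #|gverts C| = 3%N.

Definition connected G : Prop :=
  gverts G != set0 /\ {in gverts G &, forall x y, connect (adj G) x y}.

Definition cut_vertex G (v : V) : Prop :=
  v \in gverts G /\
  exists x y, [/\ x \in gverts G :\ v, y \in gverts G :\ v,
    connect (adj G) x y &
    ~~ connect [rel z w | [&& adj G z w, z != v & w != v]] x y].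

Definition cut_edge G (f : {set V}) : Prop :=
  f \in gedges G /\
  exists x y, [/\ x \in gverts G, y \in gverts G, connect (adj G) x y &
    ~~ connect [rel z w | adj G z w && ([set z; w] != f)] x y].

Definition connected_without_cut_vertex G : Prop :=
  connected G /\ forall v, ~ cut_vertex G v.

(* Blocks: maximal connected subgraphs without a cut vertex of their own. *)
Definition block G B : Prop :=
  [/\ subgraph B G, connected_without_cut_vertex B &
    forall H, subgraph H G -> connected_without_cut_vertex H ->
      subgraph B H -> subgraph H B].

Definition is_vertex B : Prop := exists v, gverts B = [set v].

Definition is_bridge G B : Prop :=
  exists f, [/\ cut_edge G f, gverts B = f & gedges B = [set f]].

(* [K] is the edge sum of [H] and [C]: both are subgraphs of the ambient
   complete graph and share exactly one edge together with its end points. *)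
Definition edge_sum H C (K : graph V) : Prop :=
  exists f, [/\ f \in gedges H, f \in gedges C,
    gverts H :&: gverts C = f,
    gverts K = gverts H :|: gverts C &
    gedges K = gedges H :|: gedges C].

Inductive edge_sum_of_cycles : graph V -> Prop :=
| edge_sum_start C : is_cycle C -> edge_sum_of_cycles C
| edge_sum_step H C K : edge_sum_of_cycles H -> is_cycle C ->
    edge_sum H C K -> edge_sum_of_cycles K.

Definition ring_graph G : Prop :=
  forall B, block G B -> ~ is_vertex B -> ~ is_bridge G B ->
    edge_sum_of_cycles B.

Definition stable G (W : {set V}) : bool :=
  (W \subset gverts G) &&
  [forall x in W, forall y in W, (x != y) ==> ([set x; y] \notin gedges G)].

End Graphs.

(* Polytopes *)

Definition convex_hull (R : realType) (n : nat) (S : 'rV[R]_n -> Prop)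
    (x : 'rV[R]_n) : Prop :=
  exists (k : nat) (p : 'I_k -> 'rV[R]_n) (w : 'I_k -> R),
    [/\ forall i, S (p i), forall i, 0 <= w i, \sum_i w i = 1
      & x = \sum_i w i *: p i].

Definition rho (R : realType) (n : nat) (W : {set 'I_n}) : 'rV[R]_n :=
  \sum_(j in W) delta_mx 0 j.

Definition stable_set_polytope (R : realType) (n : nat) (G : graph 'I_n) :
    'rV[R]_n -> Prop :=
  convex_hull (fun x => exists2 W, stable G W & x = rho R W).
Arguments stable_set_polytope R {n} G.

(* [a] lists, without repetition, the elements of P \cap Z^n. *)
Definition lattice_points (R : realType) (n m : nat) (P : 'rV[R]_n -> Prop)
    (a : 'I_m -> 'rV[int]_n) : Prop :=
  injective a /\
  forall z : 'rV[int]_n, (exists i, a i = z) <-> P (map_mx intr z).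

(* Toric ideals.  The Laurent polynomial ring K[x_1^{\pm 1},...,x_n^{\pm 1}, t]
   is not available; the map is taken with values in K(x_1,...,x_n)[t], which
   contains it, so that the kernel is the same.  The variable t is 'X. *)

Definition laurent_monomial (K : fieldType) (n : nat) (a : 'rV[int]_n) :
    {fraction {mpoly K[n]}} :=
  \prod_(j < n) (FracField.tofrac ('X_j : {mpoly K[n]})) ^ (a 0 j).

Definition toric_map (K : fieldType) (n m : nat) (a : 'I_m -> 'rV[int]_n) :
    {mpoly K[m]} -> {poly {fraction {mpoly K[n]}}} :=
  mmap (fun c : K => (FracField.tofrac (c%:MP : {mpoly K[n]}))%:P)
       (fun i => (laurent_monomial K (a i))%:P * 'X).

Definition toric_ideal (K : fieldType) (n m : nat) (a : 'I_m -> 'rV[int]_n) :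
    {mpoly K[m]} -> Prop :=
  fun p => toric_map a p = 0.
Arguments toric_ideal K {n m} a.

(* Initial ideals *)

Record monomial_order (m : nat) (le : rel 'X_{1..m}) : Prop := MonomialOrder {
  mo_refl : reflexive le;
  mo_anti : antisymmetric le;
  mo_trans : transitive le;
  mo_total : total le;
  mo_unit : forall u, le 0%MM u;
  mo_mul : forall u v w, le u v -> le (u + w)%MM (v + w)%MM
}.

Definition ideal_generated (A : comNzRingType) (S : A -> Prop) (p : A) : Prop :=
  exists (k : nat) (c g : 'I_k -> A),
    (forall i, S (g i)) /\ p = \sum_i c i * g i.

Definition monomial_ideal (K : fieldType) (m : nat) (M : 'X_{1..m} -> Prop) :
    {mpoly K[m]} -> Prop :=
  ideal_generated (fun p => exists2 u, M u & p = 'X_[u]).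

Definition initial_monomial (K : fieldType) (m : nat) (le : rel 'X_{1..m})
    (p : {mpoly K[m]}) (u : 'X_{1..m}) : Prop :=
  u \in msupp p /\ {in msupp p, forall v, le v u}.

(* A zero polynomial has empty support, hence no initial monomial. *)
Definition initial_ideal (K : fieldType) (m : nat) (le : rel 'X_{1..m})
    (I : {mpoly K[m]} -> Prop) : {mpoly K[m]} -> Prop :=
  monomial_ideal (fun u => exists2 p, I p & initial_monomial le p u).

Definition squarefree_quadratic (m : nat) (u : 'X_{1..m}) : Prop :=
  mdeg u = 2%N /\ forall i, (u i <= 1)%N.

Definition has_squarefree_quadratic_initial_ideal (K : fieldType) (m : nat)
    (I : {mpoly K[m]} -> Prop) : Prop :=
  exists le : rel 'X_{1..m}, monomial_order le /\
  exists M : 'X_{1..m} -> Prop,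
    (forall u, M u -> squarefree_quadratic u) /\
    forall p, initial_ideal le I p <-> monomial_ideal M p.

(* Main.v *)
Require Import Defs.
From mathcomp Require Import all_boot all_order all_algebra.
From mathcomp Require Import fraction.
From mathcomp Require Import zify.
From mathcomp Require Import boolp.

(* Give every stable set [W] a weight [w W] and call a pair of stable sets good
   if it maximizes the sum of the weights among the pairs with the same sum of
   incidence vectors.  If a multiset of stable sets all of whose pairs are good
   is determined by its cardinality and the sum of its incidence vectors, then
   for a monomial order refining the weight the products of the bad pairs
   generate the initial ideal: a monomial without bad pair is the only one of
   this kind in its fiber, and every other monomial of the fiber can be reduced
   to it.  Bad pairs consist of distinct sets, because the incidence vectors are
   vertices of a cube, so the initial ideal is squarefree.
   Such weights exist for complete graphs (affine independence), for cycles and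
   for clique sums of graphs that have them, and they restrict to induced
   subgraphs.  Chordal graphs decompose into complete graphs by clique sums
   (Dirac); ring graphs decompose into their blocks by clique sums along at most
   one vertex, and the blocks into cycles by clique sums along edges. *)

Set Implicit Arguments.
Unset Strict Implicit.
Unset Printing Implicit Defensive.

Import Order.TTheory GRing.Theory Num.Theory.

Lemma set2_inj (T : finType) (x y a b : T) : [set x; y] = [set a; b] ->
  (x = a /\ y = b) \/ (x = b /\ y = a).
Proof.
move=> E; have xab : x \in [set a; b] by rewrite -E set21.
have yab : y \in [set a; b] by rewrite -E set22.
have axy : a \in [set x; y] by rewrite E set21.
have bxy : b \in [set x; y] by rewrite E set22.
case/set2P: xab => ?; case/set2P: yab => ?; subst; auto.
  by move: bxy; rewrite !inE orbb => /eqP ->; left.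
by move: axy; rewrite !inE orbb => /eqP ->; left.
Qed.

(** * Weights on stable sets *)

Section Families.
Context {V : finType}.
Implicit Types (e : rel V) (u v S : {set V}) (s t : seq {set V}).
Implicit Types (w : {set V} -> nat).

(** The diagonal is included; adjacency in a simple graph is irreflexive, so for [adj G] this is
    stability. *)
Definition stab e u := [forall x in u, forall y in u, ~~ e x y].

Lemma stabP e u : reflect {in u &, forall x y, ~~ e x y} (stab e u).
Proof.
apply: (iffP forall_inP) => [H x y xu yu|H x xu].
  by have /forall_inP := H x xu; apply.
by apply/forall_inP => y yu; exact: H.
Qed.

Definition same_sum s t :=
  forall x, count (fun u : {set V} => x \in u) s =
            count (fun u : {set V} => x \in u) t.

(** The competitors range over all stable sets; equal sums force them into [u :|: v], hence into
    every set that contains [u] and [v]. *)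
Definition good e w u v := forall u' v', stab e u' -> stab e v' ->
  same_sum [:: u; v] [:: u'; v'] -> w u' + w v' <= w u + w v.

Definition good_family e S w s :=
  {in s, forall u, stab e u /\ u \subset S} /\ {in s &, forall u v, good e w u v}.

Definition quadratic_weight e S w := forall s t,
  good_family e S w s -> good_family e S w t ->
  size s = size t -> same_sum s t -> perm_eq s t.

Definition has_quadratic_weight e S := exists w, quadratic_weight e S w.

Lemma same_sum_sub u v u' v' : same_sum [:: u; v] [:: u'; v'] ->
  (u' \subset u :|: v) && (v' \subset u :|: v).
Proof.
move=> H; apply/andP; split; apply/subsetP => x xu; have /= := H x;
  by rewrite inE xu; case: (x \in u); case: (x \in v) => //=; lia.
Qed.

Lemma good_family_rem e S w s x :
  good_family e S w s -> good_family e S w (rem x s).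
Proof.
move=> [H1 H2]; split=> [u /mem_rem|u v /mem_rem us /mem_rem]; first exact: H1.
exact: H2.
Qed.

(** Removing a common member preserves goodness, equality of sizes and equality of sums, so by
    induction on the size one common member suffices. *)
Lemma quadratic_weight_common e S w :
  (forall s t, good_family e S w s -> good_family e S w t ->
    size s = size t -> same_sum s t -> s != [::] ->
    exists2 x, x \in s & x \in t) ->
  quadratic_weight e S w.
Proof.
move=> common s; elim: {s}(size s).+1 {-2}s (ltnSn (size s)) => // n IHn s.
rewrite ltnS => sn t gs gt st Hst.
case: (altP (s =P [::])) => [s0|s0].
  by move: st; rewrite s0 /= => /esym/size0nil ->.
have [x xs xt] := common s t gs gt st Hst s0.
have ps := perm_to_rem xs; have pt := perm_to_rem xt.
rewrite (permPl ps) perm_sym (permPl pt) perm_cons perm_sym.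
apply: IHn; try exact: good_family_rem.
- by rewrite size_rem //; case: (s) s0 sn.
- by rewrite !size_rem // st.
- move=> y; have := Hst y; move/permP: ps => ->; move/permP: pt => ->.
  by move=> /= /eqP; rewrite eqn_add2l => /eqP.
Qed.

Lemma has_quadratic_weight_sub e S S' :
  S' \subset S -> has_quadratic_weight e S -> has_quadratic_weight e S'.
Proof.
move=> sS [w Hw]; exists w => s t gs gt.
suff H r : good_family e S' w r -> good_family e S w r by apply: Hw; exact: H.
move=> [g1 g2]; split=> // u ur.
by have [-> uS] := g1 u ur; rewrite (subset_trans uS).
Qed.

Lemma eq_stab e e' S u : {in S &, e =2 e'} -> u \subset S ->
  stab e u = stab e' u.
Proof.
move=> ee uS; apply/stabP/stabP => H x y xu yu.
  by rewrite -ee ?(subsetP uS) ?H.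
by rewrite ee ?(subsetP uS) ?H.
Qed.

Lemma eq_has_quadratic_weight e e' S : {in S &, e =2 e'} ->
  has_quadratic_weight e S -> has_quadratic_weight e' S.
Proof.
move=> ee [w Hw]; exists w => s t gs gt.
suff H r : good_family e' S w r -> good_family e S w r by apply: Hw; exact: H.
move=> [g1 g2]; split=> [u ur|u v ur vr u' v' su sv H].
  by have [? uS] := g1 u ur; rewrite (eq_stab ee uS).
have /andP[u'S v'S] := same_sum_sub H.
have uvS : u :|: v \subset S by rewrite subUset (g1 u ur).2 (g1 v vr).2.
apply: g2 => //; first by rewrite -(eq_stab ee) // (subset_trans u'S).
by rewrite -(eq_stab ee) // (subset_trans v'S).
Qed.

Definition clique e S := {in S &, forall x y, x != y -> e x y}.

Lemma stab_clique e S u : clique e S -> stab e u -> u \subset S ->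
  {in u &, forall x y, x = y}.
Proof.
move=> cS /stabP su uS x y xu yu; apply/eqP/contraT => xy.
by have := su x y xu yu; rewrite cS ?(subsetP uS).
Qed.

(** Stable subsets of a clique are empty or singletons. A vertex of a member of [s] lies in some
    member of [t], and both are then that singleton; otherwise all members are empty. *)
Lemma clique_has_quadratic_weight e S :
  clique e S -> has_quadratic_weight e S.
Proof.
move=> cS; exists (fun=> 0); apply: quadratic_weight_common.
move=> s t [gs _] [gt _] st Hst s0.
have [/hasP[u us /set0Pn[x xu]]|] := boolP (has (fun u => u != set0) s).
  have : 0 < count (fun u : {set V} => x \in u) t.
    by rewrite -Hst -has_count; apply/hasP; exists u.
  rewrite -has_count => /hasP[v vt xv]; exists u => //.
  suff -> : u = v by [].
  have [su uS] := gs u us; have [sv vS] := gt v vt.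
  apply/setP => y; apply/idP/idP => yin.
    by rewrite -(stab_clique cS su uS xu yin).
  by rewrite -(stab_clique cS sv vS xv yin).
move=> /hasPn /= s00.
case: s s0 s00 gs st Hst => // u s _ s00 gs st Hst.
have u0 : u = set0 by apply/eqP; have := s00 u (mem_head _ _); rewrite negbK.
exists u; first exact: mem_head.
case: t gt st Hst => // v t gt _ Hst; rewrite inE u0.
suff -> : v = set0 by rewrite eqxx.
apply/eqP/set0Pn => -[x xv].
have := Hst x; rewrite [in RHS]/= xv.
suff -> : count (fun u : {set V} => x \in u) (u :: s) = 0 by [].
apply/eqP; rewrite -leqn0 leqNgt -has_count; apply/hasPn => y /s00.
by rewrite negbK => /eqP ->; rewrite inE.
Qed.

End Families.

(** * Clique sums *)

Lemma max_exists (T : eqType) (s : seq T) (p : T -> bool) (f : T -> nat) x :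
  x \in s -> p x -> exists2 y, (y \in s) && p y &
    forall z, z \in s -> p z -> f z <= f y.
Proof.
elim: s x => // a s IHs x; rewrite inE.
have [/hasP[b bs pb] _ _|/hasPn np] := boolP (has p s).
  have [y /andP[ys py] ymax] := IHs b bs pb.
  have [/andP[pa fya]|] := boolP (p a && (f y <= f a)).
    exists a; first by rewrite mem_head.
    move=> z; rewrite inE => /predU1P[->//|zs pz].
    by apply: leq_trans fya; exact: ymax.
  rewrite negb_and => nn; exists y; first by rewrite inE ys orbT.
  move=> z; rewrite inE => /predU1P[->|]; last exact: ymax.
  by move=> pa; move: nn; rewrite pa /= -ltnNge => /ltnW.
move=> /predU1P[->|/np/negPf-> //] pa; exists a; first by rewrite mem_head.
by move=> z; rewrite inE => /predU1P[->//|/np/negPf->].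
Qed.

Section CliqueSum.
Context {V : finType}.
Implicit Types (u v U : {set V}) (s t : seq {set V}).

Lemma stab_sub (e : rel V) u v : u \subset v -> stab e v -> stab e u.
Proof.
move=> uv /stabP sv; apply/stabP => x y xu yu.
by apply: sv; exact: (subsetP uv).
Qed.

(** [M] bounds the rank terms of the original pair, so the factor [M + 1] lets the weights decide;
    [Z] and [Z'], the contributions of the untouched side, cancel. *)
Lemma lex_weight M X Y X' Y' Z Z' a b a' b' : a + b <= M ->
  (M + 1) * (X' + Z) + a' + ((M + 1) * (Y' + Z') + b') <=
  (M + 1) * (X + Z) + a + ((M + 1) * (Y + Z') + b) -> X' + Y' <= X + Y.
Proof.
move=> abM; rewrite !mulnDr => le; rewrite leqNgt; apply/negP => lt.
have : (M + 1) * (X + Y + 1) <= (M + 1) * (X' + Y').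
  by rewrite leq_mul2l [X + Y + 1]addn1 lt orbT.
rewrite !mulnDr; lia.
Qed.

Lemma eq_mem_set u v x : u = v -> (x \in u) = (x \in v).
Proof. by move->. Qed.

Lemma mem_same_sum u v u' v' x : same_sum [:: u; v] [:: u'; v'] ->
  (x \in u) + (x \in v) = (x \in u') + (x \in v').
Proof. by move=> /(_ x) /=; rewrite !addn0. Qed.

Lemma same_sum2 u v u' v' :
  (forall x, (x \in u) + (x \in v) = (x \in u') + (x \in v')) ->
  same_sum [:: u; v] [:: u'; v'].
Proof. by move=> H x /=; rewrite !addn0. Qed.

(* The incidence vectors of the empty set and of the vertices of a clique are
   affinely independent. *)
Lemma same_sum_clique (e : rel V) K u v u' v' : clique e K ->
  stab e u -> stab e v -> stab e u' -> stab e v' ->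
  same_sum [:: u; v] [:: u'; v'] ->
  (u' :&: K = u :&: K /\ v' :&: K = v :&: K) \/
  (v' :&: K = u :&: K /\ u' :&: K = v :&: K).
Proof.
move=> cK su sv su' sv' H.
have atmost W x y : stab e W -> x \in W -> y \in W -> x \in K -> y \in K -> x = y.
  move=> sW xW yW xK yK.
  apply: (stab_clique cK (stab_sub (subsetIl W K) sW) (subsetIr _ _));
    by rewrite inE ?xW ?yW ?xK ?yK.
(* A stable set meets [K] in at most one vertex: a shared vertex [a] equates the traces of [A] and
   [C], and the sums then equate those of [B] and [D]. *)
have P1 (A B C D : {set V}) a : stab e A -> stab e C ->
    (forall x, (x \in A) + (x \in B) = (x \in C) + (x \in D)) ->
    a \in K -> a \in A -> a \in C -> C :&: K = A :&: K /\ D :&: K = B :&: K.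
  move=> sA sC E aK aA aC.
  have AC x : x \in K -> (x \in C) = (x \in A).
    move=> xK; apply/idP/idP => xin; first by rewrite (atmost C x a).
    by rewrite (atmost A x a).
  split; apply/setP => x; rewrite !inE; have [xK|] := boolP (x \in K);
    rewrite ?andbF ?andbT //; first exact: AC.
  have := E x; rewrite AC //; case: (x \in A); case: (x \in B);
    case: (x \in D) => //=; lia.
have E x := mem_same_sum x H.
have E2 x : (x \in v) + (x \in u) = (x \in v') + (x \in u').
  by rewrite addnC E addnC.
have E3 x : (x \in u) + (x \in v) = (x \in v') + (x \in u').
  by rewrite E addnC.
have E4 x : (x \in v) + (x \in u) = (x \in u') + (x \in v').
  by rewrite -E addnC.
have [/set0Pn[a]|/negPn/eqP u0] := boolP (u :&: K != set0).
  rewrite inE => /andP[au aK].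
  have [au'|nau'] := boolP (a \in u').
    by left; exact: (P1 _ _ _ _ a su su' E).
  have av' : a \in v' by have := E a; rewrite au (negPf nau'); case: (a \in v').
  by right; exact: (P1 _ _ _ _ a su sv' E3).
have [/set0Pn[a]|/negPn/eqP v0] := boolP (v :&: K != set0).
  rewrite inE => /andP[av aK].
  have [au'|nau'] := boolP (a \in u').
    by right; have [] := P1 _ _ _ _ a sv su' E4 aK av au'.
  have av' : a \in v'.
    by have := E a; rewrite av (negPf nau'); case: (a \in v'); case: (a \in u).
  by left; have [] := P1 _ _ _ _ a sv sv' E2 aK av av'.
left; have N x : x \in K -> (x \in u' = false) * (x \in v' = false).
  move=> xK; have := E x; have := eq_mem_set x u0; have := eq_mem_set x v0.
  rewrite !inE xK !andbT => -> ->; by case: (x \in u'); case: (x \in v').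
rewrite u0 v0; split; apply/setP => x; rewrite !inE;
  by have [/N E'|] := boolP (x \in K); rewrite ?E' ?andbF.
Qed.

Lemma count_map_setI (X : {set V}) s x :
  count (fun u => x \in u) [seq u :&: X | u <- s] =
  if x \in X then count (fun u : {set V} => x \in u) s else 0.
Proof.
rewrite count_map; case: ifP => xX.
  by apply: eq_count => u /=; rewrite inE xX andbT.
by rewrite -(count_pred0 s); apply: eq_count => u /=; rewrite inE xX andbF.
Qed.

Context (e : rel V) (V1 V2 : {set V}) (w1 w2 : {set V} -> nat).
Hypothesis e_sym : symmetric e.
Hypothesis cK : clique e (V1 :&: V2).
Hypothesis cross : forall x y, x \in V1 -> x \notin V2 -> y \in V2 ->
  y \notin V1 -> ~~ e x y.
Hypothesis Hw1 : quadratic_weight e V1 w1.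
Hypothesis Hw2 : quadratic_weight e V2 w2.

Let rk (u : {set V}) : nat := enum_rank u.
Let N := #|{: {set V}}|.

(* The second summand only decides between the ways of pairing restrictions
   to [V1] with restrictions to [V2]; it is maximal when the pairing is
   monotone for the ranks. *)
Definition clique_sum_weight u :=
  (2 * N * N + 1) * (w1 (u :&: V1) + w2 (u :&: V2)) +
  rk (u :&: V1) * rk (u :&: V2).

Let rkN u : rk u < N. Proof. exact: ltn_ord. Qed.

Lemma clique_sum_glue u1 u2 : stab e u1 -> stab e u2 ->
  u1 \subset V1 -> u2 \subset V2 -> u1 :&: (V1 :&: V2) = u2 :&: (V1 :&: V2) ->
  [/\ stab e (u1 :|: u2), (u1 :|: u2) :&: V1 = u1 & (u1 :|: u2) :&: V2 = u2].
Proof.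
move=> s1 s2 /subsetP sub1 /subsetP sub2 E.
have E12 x : x \in V1 -> x \in V2 -> (x \in u1) = (x \in u2).
  by move=> x1 x2; have := eq_mem_set x E; rewrite !inE x1 x2 !andbT.
split.
- have H x y : x \in u1 -> y \in u2 -> ~~ e x y.
    move=> xu yu; have x1 := sub1 _ xu; have y2 := sub2 _ yu.
    have [x2|nx2] := boolP (x \in V2).
      by apply: (stabP _ _ s2) => //; rewrite -E12.
    have [y1|ny1] := boolP (y \in V1); last exact: cross.
    by apply: (stabP _ _ s1) => //; rewrite E12.
  apply/stabP => x y; rewrite !inE => /orP[xu|xu] /orP[yu|yu].
  + exact: (stabP _ _ s1).
  + exact: H.
  + by rewrite e_sym; exact: H.
  + exact: (stabP _ _ s2).
- apply/setP => x; rewrite !inE; apply/andP/idP => [[/orP[//|xu] x1]|xu].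
    by rewrite E12 ?sub2.
  by rewrite xu sub1.
- apply/setP => x; rewrite !inE; apply/andP/idP => [[/orP[xu|//] x2]|xu].
    by rewrite -E12 ?sub1.
  by rewrite xu orbT sub2.
Qed.

Lemma setIV12 u : (u :&: V1) :&: (V1 :&: V2) = u :&: (V1 :&: V2).
Proof.
by apply/setP => x; rewrite !inE; case: (x \in V1); rewrite ?andbF ?andbT.
Qed.

Lemma setIV21 u : (u :&: V2) :&: (V1 :&: V2) = u :&: (V1 :&: V2).
Proof.
by apply/setP => x; rewrite !inE; case: (x \in V2); rewrite ?andbF ?andbT.
Qed.

(** A better pair on [V1] could be glued to the unchanged restrictions to [V2] and would improve the
    whole pair. *)
Lemma good_setIl u v : u \subset V1 :|: V2 -> v \subset V1 :|: V2 ->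
  stab e u -> stab e v -> good e clique_sum_weight u v ->
  good e w1 (u :&: V1) (v :&: V1).
Proof.
move=> uS vS su sv g.
have s1 W : stab e W -> stab e (W :&: V1) by apply: stab_sub; exact: subsetIl.
have s2 W : stab e W -> stab e (W :&: V2) by apply: stab_sub; exact: subsetIl.
have b1 a b c d : rk a * rk b + rk c * rk d <= 2 * N * N.
  have : rk a * rk b <= N * N by apply: leq_mul; apply/ltnW/rkN.
  have : rk c * rk d <= N * N by apply: leq_mul; apply/ltnW/rkN.
  lia.
have memS (W : {set V}) x : W \subset V1 :|: V2 ->
    (x \in W) ==> ((x \in V1) || (x \in V2)).
  by move=> /subsetP WS; apply/implyP => /WS; rewrite inE.
move=> u' v' su' sv' H.
have /andP[u'1 v'1] : (u' \subset V1) && (v' \subset V1).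
  have /andP[A B] := same_sum_sub H.
  by rewrite (subset_trans A) ?(subset_trans B) // subUset !subsetIr.
(* Gluing requires matching traces on the clique; they match up to swapping [u'] and [v']. *)
wlog [Ku Kv] : u' v' su' sv' H u'1 v'1 /
    u' :&: (V1 :&: V2) = u :&: (V1 :&: V2) /\ v' :&: (V1 :&: V2) = v :&: (V1 :&: V2).
  move=> hwlog.
  have := same_sum_clique cK (s1 _ su) (s1 _ sv) su' sv' H.
  rewrite !setIV12 => -[K|[K1 K2]]; first exact: hwlog.
  rewrite [w1 u' + _]addnC; apply: hwlog => //.
  by apply: same_sum2 => x; rewrite (mem_same_sum x H) addnC.
have [|||||A1 A2 A3] := @clique_sum_glue u' (u :&: V2);
  rewrite ?setIV21 ?subsetIr //; auto.
have [|||||B1 B2 B3] := @clique_sum_glue v' (v :&: V2);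
  rewrite ?setIV21 ?subsetIr //; auto.
have := g _ _ A1 B1; rewrite /clique_sum_weight A2 A3 B2 B3 => gg.
have /gg : same_sum [:: u; v] [:: u' :|: u :&: V2; v' :|: v :&: V2].
  apply: same_sum2 => x; have := mem_same_sum x H.
  have := eq_mem_set x A2; have := eq_mem_set x A3.
  have := eq_mem_set x B2; have := eq_mem_set x B3.
  have := memS u x uS; have := memS v x vS.
  have := introT implyP (subsetP u'1 x); have := introT implyP (subsetP v'1 x).
  rewrite !inE; by do 6! [case: (x \in _) => //=].
have b2 := b1 (u :&: V1) (u :&: V2) (v :&: V1) (v :&: V2).
by move=> gle; exact: lex_weight b2 gle.
Qed.

(** Exchanging the restrictions to [V2] keeps the sum of the incidence vectors and the leading terms
    of the weights. By the rearrangement inequality it would increase the rank products if the ranks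
    were oppositely ordered. *)
Lemma good_monotone u v : u \subset V1 :|: V2 -> v \subset V1 :|: V2 ->
  stab e u -> stab e v -> good e clique_sum_weight u v ->
  u :&: (V1 :&: V2) = v :&: (V1 :&: V2) ->
  rk (u :&: V1) < rk (v :&: V1) -> rk (u :&: V2) <= rk (v :&: V2).
Proof.
move=> uS vS su sv g K lt1; rewrite leqNgt; apply/negP => lt2.
have s1 W : stab e W -> stab e (W :&: V1) by apply: stab_sub; exact: subsetIl.
have s2 W : stab e W -> stab e (W :&: V2) by apply: stab_sub; exact: subsetIl.
have memS (W : {set V}) x : W \subset V1 :|: V2 ->
    (x \in W) ==> ((x \in V1) || (x \in V2)).
  by move=> /subsetP WS; apply/implyP => /WS; rewrite inE.
have [|||||A1 A2 A3] := @clique_sum_glue (u :&: V1) (v :&: V2);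
  rewrite ?setIV12 ?setIV21 ?subsetIr //; auto.
have [|||||B1 B2 B3] := @clique_sum_glue (v :&: V1) (u :&: V2);
  rewrite ?setIV12 ?setIV21 ?subsetIr //; auto.
have := g _ _ A1 B1; rewrite /clique_sum_weight A2 A3 B2 B3 => gg.
have /gg : same_sum [:: u; v] [:: u :&: V1 :|: v :&: V2; v :&: V1 :|: u :&: V2].
  apply: same_sum2 => x; have := eq_mem_set x K.
  have := memS u x uS; have := memS v x vS.
  by rewrite !inE; do 4! case: (x \in _).
move: lt1 lt2.
set a := rk _; set b := rk _; set c := rk _; set d := rk _.
move: (2 * N * N) => M; nia.
Qed.

End CliqueSum.

Lemma good_setIr (V : finType) (e : rel V) (V1 V2 : {set V}) w1 w2 (u v : {set V}) :
  symmetric e -> clique e (V1 :&: V2) ->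
  (forall x y, x \in V1 -> x \notin V2 -> y \in V2 -> y \notin V1 -> ~~ e x y) ->
  u \subset V1 :|: V2 -> v \subset V1 :|: V2 -> stab e u -> stab e v ->
  good e (clique_sum_weight V1 V2 w1 w2) u v ->
  good e w2 (u :&: V2) (v :&: V2).
Proof.
move=> es cK cross uS vS su sv g.
apply: (@good_setIl _ e V2 V1 w2 w1) => //;
  rewrite ?[V2 :&: _]setIC ?[V2 :|: _]setUC //.
  by move=> x y *; rewrite es; exact: cross.
move=> u' v' su' sv' /(g _ _ su' sv'); rewrite /clique_sum_weight.
by rewrite ![w2 _ + w1 _]addnC ![enum_rank (_ :&: V2) * _]mulnC.
Qed.

Section CliqueSumQuadratic.
Context {V : finType}.
Implicit Types (u v U : {set V}) (s t : seq {set V}).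

Context (e : rel V) (V1 V2 : {set V}) (w1 w2 : {set V} -> nat).
Hypothesis e_sym : symmetric e.
Hypothesis cK : clique e (V1 :&: V2).
Hypothesis cross : forall x y, x \in V1 -> x \notin V2 -> y \in V2 ->
  y \notin V1 -> ~~ e x y.
Hypothesis Hw1 : quadratic_weight e V1 w1.
Hypothesis Hw2 : quadratic_weight e V2 w2.

Let rk (u : {set V}) : nat := enum_rank u.

(** The restrictions of [s] and [t] to each side agree as multisets. Among the members with a fixed
    trace on the clique, monotonicity gives one maximal for both ranks; the two multisets determine
    it, so it is common to [s] and [t]. *)
Lemma clique_sum_quadratic_weight :
  quadratic_weight e (V1 :|: V2) (clique_sum_weight V1 V2 w1 w2).
Proof.
have s1 W : stab e W -> stab e (W :&: V1) by apply: stab_sub; exact: subsetIl.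
have s2 W : stab e W -> stab e (W :&: V2) by apply: stab_sub; exact: subsetIl.
have F1 s : good_family e (V1 :|: V2) (clique_sum_weight V1 V2 w1 w2) s ->
    good_family e V1 w1 [seq u :&: V1 | u <- s].
  move=> [g1 g2]; split=> [_ /mapP[u us ->]|_ _ /mapP[u us ->] /mapP[v vs ->]].
    by rewrite subsetIr s1 //; have [] := g1 u us.
  by have [? ?] := g1 u us; have [? ?] := g1 v vs;
    apply: (@good_setIl _ _ V1 V2 w1 w2); auto.
have F2 s : good_family e (V1 :|: V2) (clique_sum_weight V1 V2 w1 w2) s ->
    good_family e V2 w2 [seq u :&: V2 | u <- s].
  move=> [g1 g2]; split=> [_ /mapP[u us ->]|_ _ /mapP[u us ->] /mapP[v vs ->]].
    by rewrite subsetIr s2 //; have [] := g1 u us.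
  by have [? ?] := g1 u us; have [? ?] := g1 v vs;
    apply: (@good_setIr _ _ V1 V2 w1 w2); auto.
have setIS u : u \subset V1 :|: V2 -> u = u :&: V1 :|: u :&: V2.
  by move=> uS; rewrite -setIUr; apply/esym/setIidPl.
apply: quadratic_weight_common => s t gs gt st Hst s0.
have p1 : perm_eq [seq u :&: V1 | u <- s] [seq u :&: V1 | u <- t].
  apply: Hw1; rewrite ?size_map; auto.
  by move=> x; rewrite !count_map_setI Hst.
have p2 : perm_eq [seq u :&: V2 | u <- s] [seq u :&: V2 | u <- t].
  apply: Hw2; rewrite ?size_map; auto.
  by move=> x; rewrite !count_map_setI Hst.
pose K := V1 :&: V2.
have top r a c :
    good_family e (V1 :|: V2) (clique_sum_weight V1 V2 w1 w2) r -> a \in r ->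
    a :&: K = c -> exists x, [/\ x \in r, x :&: K = c,
    forall y, y \in r -> y :&: K = c -> rk (y :&: V1) <= rk (x :&: V1) &
    forall y, y \in r -> y :&: K = c -> rk (y :&: V2) <= rk (x :&: V2)].
  move=> [g1 g2] ar /eqP ac.
  have [x1 /andP[x1r /eqP x1c] m1] :=
    max_exists (p := fun y => y :&: K == c) (fun y => rk (y :&: V1)) ar ac.
  have [x2 /andP[x2r /eqP x2c] m2] :=
    max_exists (p := fun y => y :&: K == c) (fun y => rk (y :&: V2)) ar ac.
  (* If [x2] is also maximal on [V1] it serves; otherwise monotonicity makes [x1] maximal on
     [V2]. *)
  have := m1 x2 x2r; rewrite x2c eqxx leq_eqVlt => /(_ isT)/orP[/eqP E|lt12].
    exists x2; split=> // y yr /eqP yc; last exact: m2.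
    by rewrite E; exact: m1.
  exists x1; split=> // y yr /eqP yc; first exact: m1.
  apply: leq_trans (m2 y yr yc) _.
  have [? ?] := g1 _ x1r; have [? ?] := g1 _ x2r.
  by apply: (@good_monotone _ _ V1 V2 w1 w2 e_sym cross x2 x1) => //;
    [exact: g2 | rewrite x1c x2c].
case: s s0 => // a s _ in gs st Hst p1 p2 *.
have [x [xs xc m1 m2]] := top _ a _ gs (mem_head _ _) erefl.
have mem1 : x :&: V1 \in [seq u :&: V1 | u <- t].
  by rewrite -(perm_mem p1); apply/mapP; exists x.
have [b bt bx] := mapP mem1.
have bc : b :&: K = a :&: K by rewrite -(setIV12 V1 V2) -bx setIV12.
have [z [zt zc n1 n2]] := top _ b _ gt bt bc.
have xz1 : x :&: V1 = z :&: V1.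
  apply: enum_rank_inj; apply/val_inj/eqP; rewrite eqn_leq; apply/andP; split.
    by rewrite bx; exact: n1.
  have : z :&: V1 \in [seq u :&: V1 | u <- a :: s].
    by rewrite (perm_mem p1); apply/mapP; exists z.
  case/mapP => y ys yz; rewrite yz; apply: m1 => //.
  by rewrite -(setIV12 V1 V2) -yz setIV12.
have xz2 : x :&: V2 = z :&: V2.
  apply: enum_rank_inj; apply/val_inj/eqP; rewrite eqn_leq; apply/andP; split.
    have : x :&: V2 \in [seq u :&: V2 | u <- t].
      by rewrite -(perm_mem p2); apply/mapP; exists x.
    case/mapP => y yt yx; rewrite yx; apply: n2 => //.
    by rewrite -(setIV21 V1 V2) -yx setIV21.
  have : z :&: V2 \in [seq u :&: V2 | u <- a :: s].
    by rewrite (perm_mem p2); apply/mapP; exists z.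
  case/mapP => y ys yz; rewrite yz; apply: m2 => //.
  by rewrite -(setIV21 V1 V2) -yz setIV21.
exists x => //.
rewrite (setIS x) ?xz1 ?xz2 -?setIS //; first by case: gt => /(_ z zt)[].
by case: gs => /(_ x xs)[].
Qed.

End CliqueSumQuadratic.

Lemma clique_sum_has_quadratic_weight (V : finType) (e : rel V) (V1 V2 : {set V}) :
  symmetric e -> clique e (V1 :&: V2) ->
  (forall x y, x \in V1 -> x \notin V2 -> y \in V2 -> y \notin V1 -> ~~ e x y) ->
  has_quadratic_weight e V1 -> has_quadratic_weight e V2 ->
  has_quadratic_weight e (V1 :|: V2).
Proof.
move=> es cK cr [w1 h1] [w2 h2]; exists (clique_sum_weight V1 V2 w1 w2).
exact: clique_sum_quadratic_weight.
Qed.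

(** * Cycles *)

Lemma leq_in_count (T : eqType) (s : seq T) (a b : pred T) :
  {in s, forall x, a x -> b x} -> count a s <= count b s.
Proof.
elim: s => //= x s IHs ab; apply: leq_add.
  by have := ab x (mem_head _ _); case: (a x) => // ->.
by apply: IHs => y ys; apply: ab; rewrite inE ys orbT.
Qed.

(** For the last [j] the index [j.+1] is out of range, and the default [z] supplies the first
    vertex, closing the cycle. *)
Lemma next_nth_cons (T : eqType) (z : T) (p : seq T) j :
  uniq (z :: p) -> j < size (z :: p) ->
  next (z :: p) (nth z (z :: p) j) = nth z (z :: p) j.+1.
Proof. by move=> up jk; rewrite next_nth mem_nth // index_uniq. Qed.

Section CycleWeight.
Context {V : finType} (e : rel V) (z : V) (p : seq V).
Implicit Types (u v T Y : {set V}) (s t : seq {set V}).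

Let c := z :: p.
Let k := size c.
Let S := [set x in c].

(* The default value makes [vx k = vx 0]. *)
Let vx j := nth z c j.

Hypothesis c_uniq : uniq c.
Hypothesis e_next : forall j, j < k -> e (vx j) (vx j.+1).
Hypothesis e_cycle : forall x y, x \in c -> y \in c -> e x y ->
  exists2 j, j < k & (x = vx j /\ y = vx j.+1) \/ (x = vx j.+1 /\ y = vx j).

(* In these coordinates stability of consecutive vertices becomes an order
   relation: the bit at an odd position is at most the bits at the two
   neighbouring (even) positions. *)
Definition cycle_bit u j : bool := if odd j then vx j \in u else vx j \notin u.
Local Notation bit := cycle_bit.

(** The extra [k * bit u 0] makes the bit at [0] dominate the rank, which supplies the boundary
    condition at [0] for the exchanges below. *)
Definition cycle_rank u := \sum_(j < k) bit u j + k * bit u 0.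

Lemma vx_size : vx k = vx 0.
Proof. by rewrite /vx nth_default. Qed.

Lemma index_vx j : j < k -> index (vx j) c = j.
Proof. by move=> jk; rewrite index_uniq. Qed.

(** Position [k] is the vertex at [0] again, read with the parity of [k]: in an odd cycle the bit is
    complemented. *)
Lemma cycle_bit_size u : bit u k = bit u 0 (+) odd k.
Proof. by rewrite /bit vx_size; case: (odd k) => /=; case: (_ \in _). Qed.

Lemma stab_cycle u : u \subset S -> reflect
  (forall j, j < k -> if odd j then bit u j ==> bit u j.+1
                      else bit u j.+1 ==> bit u j)
  (stab e u).
Proof.
move=> uS; apply: (iffP (stabP e u)) => [H j jk|H x y xu yu].
  rewrite /bit /=; case: (odd j) => /=; apply/implyP => xin; apply/negP => yin.
    by have := H _ _ xin yin; rewrite e_next.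
  by have := H _ _ yin xin; rewrite e_next.
have xc : x \in c by have := subsetP uS _ xu; rewrite inE.
have yc : y \in c by have := subsetP uS _ yu; rewrite inE.
apply/negP => /(e_cycle xc yc)[j jk E]; have := H j jk; rewrite /bit /=.
by case: E => -[Ex Ey]; subst x y; rewrite xu yu; case: (odd j).
Qed.

Section Exchange.
Variables (i : nat) (T Y : {set V}).
Hypothesis ik : i <= k.

(** Exchanging memberships on [D] turns the bits strictly between [0] and [i] into their maximum for
    [T'] and their minimum for [Y']. *)
Let D := [set x | [&& 0 < index x c, index x c < i,
                      ~~ bit T (index x c) & bit Y (index x c)]].
Let T' := (T :\: D) :|: (Y :&: D).
Let Y' := (Y :\: D) :|: (T :&: D).
Let d j := [&& 0 < j, j < i, ~~ bit T j & bit Y j].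

Lemma mem_exchange j : j <= k -> (vx j \in D) = d j.
Proof.
rewrite inE leq_eqVlt => /predU1P[->|jk]; last by rewrite index_vx.
by rewrite vx_size index_vx // /d ltnn /= [k < i]ltnNge ik.
Qed.

Lemma bit_exchangeT j : j <= k -> bit T' j = if d j then true else bit T j.
Proof.
move=> jk; rewrite /bit !(in_setU, in_setD, in_setI) mem_exchange // /d /bit.
by case: (odd j); case: (0 < j); case: (j < i); case: (vx j \in T);
  case: (vx j \in Y).
Qed.

Lemma bit_exchangeY j : j <= k -> bit Y' j = if d j then false else bit Y j.
Proof.
move=> jk; rewrite /bit !(in_setU, in_setD, in_setI) mem_exchange // /d /bit.
by case: (odd j); case: (0 < j); case: (j < i); case: (vx j \in T);
  case: (vx j \in Y).
Qed.

Lemma same_sum_exchange : same_sum [:: T; Y] [:: T'; Y'].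
Proof.
apply: same_sum2 => x; rewrite !inE.
by case: [&& _, _, _ & _]; case: (x \in T); case: (x \in Y).
Qed.

Hypotheses (TS : T \subset S) (YS : Y \subset S).
Hypotheses (sT : stab e T) (sY : stab e Y).
Hypotheses (TY0 : bit Y 0 ==> bit T 0) (TYi : bit Y i ==> bit T i).

(** The hypotheses at [0] and [i] extend the description by maxima and minima to all positions from
    [0] to [i]. Maxima and minima preserve the order relations of [stab_cycle], and from [i] on
    nothing changes. *)
Lemma stab_exchange : stab e T' /\ stab e Y'.
Proof.
have /andP[T'S Y'S] : (T' \subset S) && (Y' \subset S).
  have uS : T :|: Y \subset S by rewrite subUset TS.
  have /andP[A B] := same_sum_sub same_sum_exchange.
  by rewrite !(subset_trans _ uS).
have dT j : j <= i -> (if d j then true else bit T j) = bit T j || bit Y j.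
  rewrite /d leq_eqVlt => /predU1P[->|->].
    by rewrite ltnn andbF; case: (bit T i) TYi; case: (bit Y i).
  case: posnP => [->|_] /=; last by case: (bit T j); case: (bit Y j).
  by case: (bit T 0) TY0; case: (bit Y 0).
have dY j : j <= i -> (if d j then false else bit Y j) = bit T j && bit Y j.
  rewrite /d leq_eqVlt => /predU1P[->|->].
    by rewrite ltnn andbF; case: (bit T i) TYi; case: (bit Y i).
  case: posnP => [->|_] /=; last by case: (bit T j); case: (bit Y j).
  by case: (bit T 0) TY0; case: (bit Y 0).
have d0 j : i <= j -> d j = false by rewrite /d [j < i]ltnNge => ->; rewrite andbF.
split; apply/stab_cycle => // j jk; have jk' := ltnW jk;
    have := elimT (stab_cycle TS) sT _ jk; have := elimT (stab_cycle YS) sY _ jk.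
- rewrite !bit_exchangeT //; case: (ltngtP j i) => [ji|ij|ji].
  + rewrite !dT //; last exact: ltnW.
    by case: (odd j); case: (bit T j); case: (bit Y j); case: (bit T j.+1);
      case: (bit Y j.+1).
  + by rewrite !d0 ?(ltnW ij) // ltnW // ltnW.
  + by rewrite !d0 ?ji.
- rewrite !bit_exchangeY //; case: (ltngtP j i) => [ji|ij|ji].
  + rewrite !dY //; last exact: ltnW.
    by case: (odd j); case: (bit T j); case: (bit Y j); case: (bit T j.+1);
      case: (bit Y j.+1).
  + by rewrite !d0 ?(ltnW ij) // ltnW // ltnW.
  + by rewrite !d0 ?ji.
Qed.

Lemma cycle_rank_exchange :
  cycle_rank T' = cycle_rank T + \sum_(j < k) d j /\
  cycle_rank Y = cycle_rank Y' + \sum_(j < k) d j.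
Proof.
rewrite /cycle_rank bit_exchangeT // bit_exchangeY //=; split.
  rewrite addnAC -big_split /=; congr (_ + _); apply: eq_bigr => j _.
  rewrite bit_exchangeT ?(ltnW (ltn_ord j)) // /d.
  by case: (0 < j); case: (j < i); case: (bit T j); case: (bit Y j).
rewrite addnAC -big_split /=; congr (_ + _); apply: eq_bigr => j _.
rewrite bit_exchangeY ?(ltnW (ltn_ord j)) // /d.
by case: (0 < j); case: (j < i); case: (bit T j); case: (bit Y j).
Qed.

End Exchange.

Lemma cycle_rank_bit0 T Y : cycle_rank Y <= cycle_rank T -> bit Y 0 ==> bit T 0.
Proof.
apply: contraTT; rewrite negb_imply => /andP[Y0 /negPf T0].
rewrite -ltnNge /cycle_rank Y0 T0 muln0 muln1 addn0.
apply: (leq_trans _ (leq_addl _ _)); rewrite /k /= big_ord_recl T0 add0n ltnS.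
by rewrite -[leqRHS]card_ord -sum1_card; apply: leq_sum => j _; exact: leq_b1.
Qed.

(* Otherwise exchanging the bits at the positions [j < i] where [Y] exceeds [T]
   would increase the larger rank and decrease the smaller one. *)
Lemma good_cycle_bit T Y i j :
  T \subset S -> Y \subset S -> stab e T -> stab e Y ->
  good e (fun u => cycle_rank u ^ 2) T Y -> cycle_rank Y <= cycle_rank T ->
  j < i <= k -> bit Y i ==> bit T i -> bit Y j ==> bit T j.
Proof.
move=> TS YS sT sY g le /andP[ji ik] Hi.
have H0 := cycle_rank_bit0 le.
have [sT' sY'] := stab_exchange ik TS YS sT sY H0 Hi.
have := g _ _ sT' sY' (same_sum_exchange _ _ _).
have [ET EY] := cycle_rank_exchange T Y ik.
rewrite ET; rewrite EY in le *.
set D := \sum_(_ < k) _ in ET EY le * => ineq.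
(* Moving the ranks apart by [D], the larger one growing, strictly increases the sum of squares
   unless [D = 0]. *)
have D0 : D = 0 by move: ineq le; rewrite !expnS !expn0 !muln1; clear; nia.
have [->//|j0] := posnP j.
apply/implyP => Yj; apply/contraT => Tj.
have jk : j < k by exact: leq_trans ji ik.
move/eqP: D0; rewrite sum_nat_eq0 => /forallP/(_ (Ordinal jk)) /=.
by rewrite j0 ji Tj Yj.
Qed.

Lemma same_sum_count_bit s t j : size s = size t -> same_sum s t ->
  count (bit^~ j) s = count (bit^~ j) t.
Proof.
move=> st H; rewrite /bit; case: (odd j); first exact: H.
apply/eqP; rewrite -(eqn_add2l (count (fun u : {set V} => vx j \in u) s)).
by rewrite {2}H !count_predC st.
Qed.

(* [T_j] can be computed from the bits of [T] above [j] and the numbers of sets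
   with a given bit, so the element of maximal rank only depends on the sum of
   the incidence vectors. *)
Lemma top_bit s T j : good_family e S (fun u => cycle_rank u ^ 2) s ->
  T \in s -> (forall Y, Y \in s -> cycle_rank Y <= cycle_rank T) ->
  0 < j < k ->
  bit T j = if [exists i : 'I_k.+1, (j < i) && bit T i]
            then 0 < count (bit^~ j) s
            else count (bit^~ j.+1) s < count (bit^~ j) s.
Proof.
move=> [g1 g2] Ts max /andP[j0 jk]; have [sT TS] := g1 T Ts.
have mono Y i : Y \in s -> j < i <= k -> bit Y i ==> bit T i ->
    bit Y j ==> bit T j.
  move=> Ys; have [sY YS] := g1 Y Ys.
  by apply: good_cycle_bit => //; [exact: g2 | exact: max].
(* A nonzero bit of [T] above [j] makes the comparison hypothesis hold for every [Y], so [T] has bit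
   [j] as soon as some member has it. *)
case: ifPn => [/existsP[i /andP[ji Ti]]|none].
  apply/idP/idP => [Tj|]; first by rewrite -has_count; apply/hasP; exists T.
  rewrite -has_count => /hasP[Y Ys Yj].
  apply: (implyP (mono Y i Ys _ _)) Yj; last by rewrite Ti implybT.
  by rewrite ji -ltnS ltn_ord.
have Tj1 : bit T j.+1 = false.
  apply/negbTE/negP => Tj1; case/existsP: none.
  by exists (Ordinal (jk : j.+1 < k.+1)); rewrite /= leqnn.
case: (boolP (bit T j)) => [Tj|nTj]; apply/esym.
  (* A drop of [T] from [j] to [j.+1] forces [j] to be even, so bit [j.+1] implies bit [j] in every
     member, and [T] makes the inequality of counts strict. *)
  have impl Y : Y \in s -> bit Y j.+1 -> bit Y j.
    move=> Ys; have [sY YS] := g1 Y Ys.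
    have := elimT (stab_cycle TS) sT _ jk; have := elimT (stab_cycle YS) sY _ jk.
    by rewrite Tj Tj1; case: (odd j) => //= /implyP.
  have ps := perm_to_rem Ts; rewrite !(permP ps) /= Tj Tj1 add0n add1n ltnS.
  apply: leq_in_count => Y /mem_rem; exact: impl.
apply/negbTE; rewrite -leqNgt; apply: leq_in_count => Y Ys Yj.
apply: contraNT nTj => nY; apply: (implyP (mono Y j.+1 Ys _ _)) Yj.
  by rewrite ltnSn.
by rewrite (negPf nY).
Qed.

Lemma cycle_quadratic_weight :
  quadratic_weight e S (fun u => cycle_rank u ^ 2).
Proof.
apply: quadratic_weight_common => s t gs gt st Hst s0.
have tops r : r != [::] -> exists2 T, T \in r &
    forall Y, Y \in r -> cycle_rank Y <= cycle_rank T.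
  case: r => // u r _.
  have [T /andP[Tr _] H] :=
    max_exists (p := fun=> true) cycle_rank (mem_head u r) isT.
  by exists T => // Y /H; apply.
have [T Ts maxT] := tops s s0.
have [U Ut maxU] : exists2 U, U \in t &
    forall Y, Y \in t -> cycle_rank Y <= cycle_rank U.
  by apply: tops; rewrite -size_eq0 -st size_eq0.
have top0 r X : X \in r -> (forall Y, Y \in r -> cycle_rank Y <= cycle_rank X) ->
    bit X 0 = (0 < count (bit^~ 0) r).
  move=> Xr max; apply/idP/idP => [X0|].
      by rewrite -has_count; apply/hasP; exists X.
  by rewrite -has_count => /hasP[Y /max/cycle_rank_bit0/implyP H /H].
have cnt j := same_sum_count_bit j st Hst.
have E0 : bit T 0 = bit U 0 by rewrite (top0 s) // (top0 t) // cnt.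
(* Descending induction from [k], whose bit is that of [0] up to parity; [top_bit] computes each
   lower bit from the higher ones and the common counts. *)
have E n j : k - j <= n -> j <= k -> bit T j = bit U j.
  elim: n j => [|n IHn] j.
    rewrite leqn0 subn_eq0 => kj jk.
    by rewrite (_ : j = k) ?cycle_bit_size ?E0 //; apply/eqP; rewrite eqn_leq jk.
  rewrite leq_eqVlt ltnS => /predU1P[kjn|]; last exact: IHn.
  have [->//|j0] := posnP j => jk.
  have jk' : j < k by rewrite -subn_gt0 kjn.
  rewrite (top_bit gs Ts maxT) ?j0 // (top_bit gt Ut maxU) ?j0 // !cnt.
  congr (if _ then _ else _); apply: eq_existsb => i.
  case: (ltnP j i) => //= ji; apply: IHn; last by rewrite -ltnS.
  by rewrite -ltnS -kjn ltn_sub2l.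
exists T => //; suff -> : T = U by [].
have [_ TS] := gs.1 T Ts; have [_ US] := gt.1 U Ut.
apply/setP => x; have [xc|xc] := boolP (x \in c); last first.
  have out u : u \subset S -> x \in u = false.
    by move=> uS; apply: contraNF xc => /(subsetP uS); rewrite inE.
  by rewrite !out.
have ik : index x c < k by rewrite index_mem.
have := E k (index x c) (leq_subr _ _) (ltnW ik).
by rewrite /bit /vx nth_index //; case: (odd _) => // /negb_inj.
Qed.

End CycleWeight.

Lemma cycle_has_quadratic_weight (V : finType) (C : graph V) :
  is_cycle C -> has_quadratic_weight (adj C) (gverts C).
Proof.
move=> [[|z p] [// k2 c_uniq -> CE]].
exists (fun u => cycle_rank z p u ^ 2).
have nxt j := next_nth_cons (j := j) c_uniq.
apply: cycle_quadratic_weight => // [j jk|x y xc yc].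
  rewrite -nxt //.
  change ([set nth z (z :: p) j; next (z :: p) (nth z (z :: p) j)] \in gedges C).
  by rewrite CE; apply/imsetP; exists (nth z (z :: p) j); rewrite ?mem_nth.
rewrite /adj /= CE => /imsetP[a ac E].
exists (index a (z :: p)); first by rewrite index_mem.
have ak : index a (z :: p) < size (z :: p) by rewrite index_mem.
have -> : nth z p (index a (z :: p)) = next (z :: p) a.
  by rewrite -[in RHS](nth_index z ac) nxt.
rewrite (nth_index z ac).
exact: set2_inj E.
Qed.

(** * Ring graphs *)

Section Separation.
Context {V : finType}.
Implicit Types (G H C B : graph V) (S K f : {set V}).

Lemma edgeP G f : f \in gedges G -> f \subset gverts G /\ #|f| = 2.
Proof.
by move=> fG; have := subsetP (gedgesP G) f fG; rewrite !inE => /andP[-> /eqP].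
Qed.

Lemma adj_sym G : symmetric (adj G).
Proof. by move=> x y; rewrite /adj /= setUC. Qed.

Lemma adj_verts G x y : adj G x y -> (x \in gverts G) && (y \in gverts G).
Proof. by move=> /edgeP[]; rewrite subUset !sub1set. Qed.

Lemma adj_neq G x y : adj G x y -> x != y.
Proof. by move=> /edgeP[_]; rewrite cards2; case: eqP. Qed.

Lemma edge_pair G f x y : f \in gedges G -> x \in f -> y \in f -> x != y ->
  [set x; y] = f.
Proof.
move=> /edgeP[_ f2] xf yf xy; apply/eqP; rewrite eqEcard f2 cards2 xy leqnn andbT.
by rewrite subUset !sub1set xf yf.
Qed.

Lemma edge_clique G f : f \in gedges G -> clique (adj G) f.
Proof. by move=> fG x y xf yf xy; rewrite /adj /= (edge_pair fG). Qed.

(** The summands overlap in the shared edge, a clique. Each is induced in the sum, since an edge of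
    one with both ends in the other joins the ends of the shared edge. *)
Lemma edge_sum_of_cycles_weight G :
  edge_sum_of_cycles G -> has_quadratic_weight (adj G) (gverts G).
Proof.
elim=> [C|H C K _ IH /cycle_has_quadratic_weight IC [f [fH fC HC -> EK]]].
  exact: cycle_has_quadratic_weight.
have adjK x y : adj K x y = adj H x y || adj C x y by rewrite /adj /= EK inE.
have sub x y : x \in gverts H -> y \in gverts H -> x \in gverts C ->
    y \in gverts C -> x != y -> adj H x y && adj C x y.
  move=> xH yH xC yC xy.
  rewrite !(edge_clique fH, edge_clique fC) -?HC ?inE ?xH ?yH //.
apply: clique_sum_has_quadratic_weight; first exact: adj_sym.
- by rewrite HC; apply: (@edge_clique K); rewrite EK inE fH.
- move=> x y xH xC yC yH; rewrite adjK; apply/norP.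
  split; apply/negP => /adj_verts/andP[]; first by rewrite (negPf yH).
  by rewrite (negPf xC).
- apply: eq_has_quadratic_weight IH => x y xH yH; rewrite adjK.
  apply/idP/orP => [|[//|xy]]; first by left.
  have /andP[xC yC] := adj_verts xy.
  by have /andP[] := sub x y xH yH xC yC (adj_neq xy).
- apply: eq_has_quadratic_weight IC => x y xC yC; rewrite adjK.
  apply/idP/orP => [|[xy|//]]; first by right.
  have /andP[xH yH] := adj_verts xy.
  by have /andP[] := sub x y xH yH xC yC (adj_neq xy).
Qed.

(** With [C] the component of [x] in [S :\: K], the sets [C :|: K] and [S :\: C] overlap in [K] and
    no edge crosses; the first misses [y], the second [x]. *)
Lemma separation_weight (e : rel V) S K x y :
  symmetric e -> K \subset S -> clique e K ->
  (forall S', S' \proper S -> has_quadratic_weight e S') ->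
  x \in S :\: K -> y \in S :\: K ->
  ~~ connect [rel z w | [&& e z w, z \in S :\: K & w \in S :\: K]] x y ->
  has_quadratic_weight e S.
Proof.
move=> esy KS cK IH xS yS; set r := [rel z w | _] => nxy.
pose C := [set z | connect r x z].
have CS z : z \in C -> z \in S :\: K.
  rewrite inE => /connectP[p xp ->]; elim/last_ind: p xp => //= p w _.
  by rewrite rcons_path last_rcons => /andP[_ /and3P[]].
have KE : (C :|: K) :&: (S :\: C) = K.
  apply/setP => z; have := introT implyP (CS z).
  have := introT implyP (subsetP KS z); rewrite !inE.
  by case: (connect r x z); case: (z \in K); case: (z \in S).
have -> : S = (C :|: K) :|: (S :\: C).
  apply/setP => z; have := introT implyP (CS z).
  have := introT implyP (subsetP KS z); rewrite !inE.
  by case: (connect r x z); case: (z \in K); case: (z \in S).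
apply: clique_sum_has_quadratic_weight => //.
- by rewrite KE.
- move=> a b; rewrite !inE => aC aS bS bC; move: aC aS bC.
  have := CS a; rewrite !inE.
  case: (boolP (connect r x a)) => //= [xa /(_ isT)/andP[aK aS] _ _|xa _ aK].
    case/norP => xb bK; apply: contra xb => ab; apply: connect_trans xa _.
    by apply: connect1; rewrite /= ab !inE aK aS bK; case/andP: bS.
  by rewrite (subsetP KS).
- apply: IH; apply/properP; split.
    by rewrite subUset KS andbT; apply/subsetP => z /CS; rewrite inE => /andP[].
  move: yS; rewrite inE => /andP[yK yS]; exists y => //.
  by rewrite !inE negb_or nxy.
- apply: IH; apply/properP; split; first exact: subsetDl.
  move: xS; rewrite inE => /andP[_ xS]; exists x => //.
  by rewrite !inE connect0.
Qed.

Lemma induced_edgesP G S :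
  [set f in gedges G | f \subset S] \subset [set f in powerset S | #|f| == 2].
Proof.
by apply/subsetP => f; rewrite !inE => /andP[/edgeP[_ ->] ->].
Qed.

Definition induced G S := Graph (induced_edgesP G S).

Lemma adj_induced G S x y :
  adj (induced G S) x y = [&& adj G x y, x \in S & y \in S].
Proof. by rewrite /adj /= inE subUset !sub1set. Qed.

(** Added edges keep all paths. This allows passing from a nonseparable subgraph to the one induced
    on its vertices. *)
Lemma spanning_nonseparable G H : gverts G = gverts H ->
  gedges G \subset gedges H ->
  connected_without_cut_vertex G -> connected_without_cut_vertex H.
Proof.
move=> EV /subsetP sE [[G0 Gc] nocut]; split.
  split; first by rewrite -EV.
  move=> x y; rewrite -EV => xG yG; have := Gc x y xG yG.
  by apply: connect_sub => z w zw; apply: connect1; exact: sE.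
move=> v [vH [x [y [xH yH _ nxy]]]]; apply: (nocut v).
split; [by rewrite EV|exists x, y; split; rewrite ?EV //].
  by apply: Gc; rewrite EV; [move: xH|move: yH]; rewrite inE => /andP[].
apply: contra nxy; apply: connect_sub => z w /and3P[zw zv wv].
by apply: connect1; rewrite /= zv wv !andbT; exact: sE.
Qed.

(** Disconnected sets split along the empty clique and sets with a cut vertex along a one-vertex
    clique, so a minimal counterexample would be nonseparable. *)
Lemma nonseparable_weight G : gverts G = setT ->
  (forall S, connected_without_cut_vertex (induced G S) ->
    has_quadratic_weight (adj G) S) ->
  forall S, has_quadratic_weight (adj G) S.
Proof.
move=> hG nonsep S; elim: {S}#|S|.+1 {-2}S (ltnSn #|S|) => // n IHn S.
rewrite ltnS => Sn.
have IH S' : S' \proper S -> has_quadratic_weight (adj G) S'.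
  by move=> S'S; apply: IHn; apply: leq_trans (proper_card S'S) Sn.
apply: contrapT => nS; apply: (nS); apply: nonsep.
have sep (K : {set V}) x y : K \subset S -> clique (adj G) K ->
    x \in S :\: K -> y \in S :\: K ->
    connect [rel z w | [&& adj G z w, z \in S :\: K & w \in S :\: K]] x y.
  move=> KS cK xS yS; apply/contraT => nxy; case: nS.
  exact: (separation_weight (adj_sym G) KS cK IH xS yS).
split; first split.
- apply/negP => /eqP /= S0; apply: nS; rewrite S0.
  by apply: clique_has_quadratic_weight => x y; rewrite inE.
- move=> x y /= xS yS; rewrite (@eq_connect _ _
    [rel z w | [&& adj G z w, z \in S :\: set0 & w \in S :\: set0]]).
    apply: sep; rewrite ?sub0set ?setD0 //.
    by move=> a b; rewrite inE.
  by move=> z w; rewrite adj_induced /= setD0.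
move=> v [/= vS [x [y [xS yS _]]]]; apply/negP; rewrite negbK.
rewrite (@eq_connect _ _
    [rel z w | [&& adj G z w, z \in S :\ v & w \in S :\ v]]); last first.
  move=> z w; rewrite -[LHS]/([&& adj (induced G S) z w, z != v & w != v]).
  rewrite adj_induced /= !in_setD1.
  by case: (z == v); case: (w == v); rewrite /= ?andbT ?andbF -?andbA.
apply: sep => //; first by rewrite sub1set.
by move=> a b; rewrite !inE => /eqP-> /eqP->; rewrite eqxx.
Qed.

(** A nonseparable [S] lies in a maximal one, [T], which induces a block. A vertex or a bridge is a
    clique, any other block is an edge sum of cycles, and the weight restricts from [T] to [S]. *)
Lemma ring_graph_weight G : gverts G = setT -> ring_graph G ->
  has_quadratic_weight (adj G) setT.
Proof.
move=> hG ring; apply: nonseparable_weight => // S nS.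
have [T /maxsetP[/asboolP nT maxT] ST] := @maxset_exists V
  (fun A => `[< connected_without_cut_vertex (induced G A) >]) S (asboolT nS).
apply: has_quadratic_weight_sub ST _.
have blockT : block G (induced G T).
  split=> //.
    by rewrite /subgraph hG subsetT; apply/subsetP => f; rewrite inE => /andP[].
  move=> H /andP[_ /subsetP HG] nH /andP[/= TH _].
  have HT : gverts H = T.
    apply: maxT TH; apply/asboolP; apply: spanning_nonseparable nH => //.
    by apply/subsetP => f fH; rewrite inE HG //; have [] := edgeP fH.
  rewrite /subgraph /= HT subxx; apply/subsetP => f fH.
  by rewrite inE HG // -HT; have [] := edgeP fH.
have [[v /= ->]|nv] := pselect (is_vertex (induced G T)).
  apply: clique_has_quadratic_weight => x y.
  by rewrite !inE => /eqP-> /eqP->; rewrite eqxx.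
have [[f [[fG _] /= -> _]]|nb] := pselect (is_bridge G (induced G T)).
  exact/clique_has_quadratic_weight/edge_clique.
have := edge_sum_of_cycles_weight (ring _ blockT nv nb).
apply: eq_has_quadratic_weight => x y xT yT.
by rewrite adj_induced /= in xT yT *; rewrite xT yT !andbT.
Qed.

End Separation.

(** * Chordal graphs *)

Section Chordal.
Context {V : finType} (G : graph V).
Implicit Types (A S : {set V}) (p : seq V).
Local Notation e := (adj G).

Let inner A := [rel x y | [&& e x y, x \in A & y \in A]].

Let inner_sym A : connect_sym (inner A).
Proof.
by apply: sym_connect_sym => x y /=; rewrite adj_sym [(x \in A) && _]andbC.
Qed.

Lemma inner_path A x p : path (inner A) x p -> path e x p && all (mem A) p.
Proof.
elim: p x => //= y p IHp x /andP[/and3P[-> _ ->]] /IHp/andP[-> ->] //.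
Qed.

(** In a shortest path with interior in [A] a chord would give a shortcut, and a repeated interior
    vertex would turn an edge into a chord. *)
Lemma shortest_path A x y : x \notin A -> y \notin A -> x != y ->
  (exists2 x1, x1 \in A & e x x1) -> (exists2 y1, y1 \in A & e y y1) ->
  {in A &, forall u v, connect (inner A) u v} -> ~~ e x y ->
  exists p, let q := x :: rcons p y in
  [/\ p != [::], all (mem A) p, uniq q,
      forall i, i <= size p -> e (nth x q i) (nth x q i.+1) &
      forall i j, i < j <= (size p).+1 -> e (nth x q i) (nth x q j) -> j = i.+1].
Proof.
move=> xA yA xy [x1 x1A xx1] [y1 y1A yy1] conA nxy.
pose good_size n :=
  `[< exists p, [/\ size p = n, all (mem A) p & path e x (rcons p y)] >].
have ex_good : exists n, good_size n.
  have /connectP[p0 /inner_path/andP[p0e p0A] lasty] := conA _ _ x1A y1A.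
  exists (size (x1 :: p0)); apply/asboolP; exists (x1 :: p0); split=> //=.
    by rewrite x1A.
  by rewrite xx1 rcons_path p0e -lasty adj_sym.
case: (ex_minnP ex_good) => n /asboolP[p [<- {n} pA pe]] minp.
exists p => /=; set q := x :: rcons p y.
have szq : size q = (size p).+2 by rewrite /= size_rcons.
have step i : i <= size p -> e (nth x q i) (nth x q i.+1).
  by move=> ip; have /(pathP x) := pe; apply; rewrite size_rcons.
have chord i j : i < j <= (size p).+1 -> e (nth x q i) (nth x q j) -> j = i.+1.
  move=> /andP[ij jp] eij; apply/eqP; rewrite eqn_leq ij andbT leqNgt.
  apply/negP => ij1; case: j ij jp eij ij1 => // j ij jp eij ij1.
  (* Position [0] of [q] is [x]: [take i p] keeps the positions [1] to [i], [drop j p] resumes at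
     [j.+1], and the chord bridges the gap. *)
  have : good_size (size (take i p ++ drop j p)).
    apply/asboolP; exists (take i p ++ drop j p); split=> //.
      by rewrite all_cat; apply/andP; split; apply/allP => z;
        [move/mem_take|move/mem_drop]; exact: (allP pA).
    have -> : take i p = take i (rcons p y) by rewrite -cats1 takel_cat //; lia.
    rewrite rcons_cat -drop_rcons //.
    rewrite cat_path; apply/andP; split; first exact: take_path.
    rewrite (drop_nth x) ?size_rcons //=; apply/andP; split; last first.
      have := pe; rewrite -{1}(cat_take_drop j.+1 (rcons p y)) cat_path => /andP[_].
      by rewrite (take_nth x) ?size_rcons // last_rcons.
    suff -> : last x (take i (rcons p y)) = nth x q i by [].
    rewrite (last_nth x) size_take size_rcons.
    have -> : i < (size p).+1 by lia.
    by case: (i) => //= i'; rewrite nth_take.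
  by move=> /minp; rewrite size_cat size_take size_drop; case: ltnP; lia.
split=> //.
- by apply: contraNneq nxy => p0; move: pe; rewrite p0 /= andbT.
- have neq i j : i < j -> j < size q -> nth x q i != nth x q j.
    rewrite szq => ij jq; apply/eqP => E.
    have [jp|] := leqP j (size p).
      have := step j jp; rewrite -E => /chord; rewrite ltnW //= ltnS jp => /(_ isT).
      by move=> [ji]; move: ij; rewrite ji ltnn.
    rewrite ltnNge -ltnS in jq *; move=> pj.
    have {pj jq} jE : j = (size p).+1 by lia.
    move: E; rewrite jE /= nth_rcons ltnn eqxx; case: i ij => [_ E|i ij E].
      by move: xy; rewrite -E eqxx.
    rewrite jE ltnS in ij; move: E; rewrite /= nth_rcons ij => E.
    by have := allP pA _ (mem_nth x ij); rewrite /= E (negPf yA).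
  change (is_true (uniq q)); apply/(uniqP x) => i j; rewrite !inE => iq jq E.
  case: (ltngtP i j) => // [ij|ji]; first by have := neq i j ij jq; rewrite E eqxx.
  by have := neq j i ji iq; rewrite E eqxx.
Qed.

Lemma induced_is_cycle z p : let c := z :: p in uniq c -> 2 < size c ->
  (forall j, j < size c -> e (nth z c j) (nth z c j.+1)) ->
  (forall i j, i < j < size c -> e (nth z c i) (nth z c j) ->
    j = i.+1 \/ i = 0 /\ j.+1 = size c) ->
  is_cycle (induced G [set x in c]).
Proof.
move=> c uc c2 step chord; exists c; split=> //.
have nxt x : x \in c -> next c x = nth z c (index x c).+1.
  move=> xc; have := next_nth_cons uc; rewrite -/c => /(_ (index x c)).
  by rewrite index_mem nth_index //; apply.
apply/setP => f; rewrite inE; apply/andP/imsetP => [[fG fC]|[x xc ->]].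
  have [_ /eqP/cards2P[u [v [uv fuv]]]] := edgeP fG; subst f.
  have cuv w : w \in [set u; v] -> w \in c.
    by move=> /(subsetP fC); rewrite in_set.
  have {fC cuv} [uc' vc'] := (cuv u (set21 _ _), cuv v (set22 _ _)).
  wlog lt : u v uv fG uc' vc' / index u c < index v c.
    move=> hwlog; case: (ltngtP (index u c) (index v c)) => [|lt|E].
    - exact: hwlog.
    - by rewrite setUC; apply: hwlog; rewrite 1?eq_sym 1?setUC.
    - by move: uv; rewrite -(nth_index z uc') E nth_index // eqxx.
  have jk : index v c < size c by rewrite index_mem.
  have := chord (index u c) (index v c); rewrite lt jk !nth_index //.
  move=> /(_ isT fG)[E|[i0 jE]].
    by exists u => //; rewrite nxt // -E nth_index.
  by exists v => //; rewrite nxt // jE nth_default // -(nth_index z uc') i0 setUC.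
have ik : index x c < size c by rewrite index_mem.
rewrite nxt //; split; first by rewrite -{1}(nth_index z xc); exact: step.
rewrite subUset !sub1set !in_set xc andTb.
have := ik; rewrite leq_eqVlt => /predU1P[->|ik'].
  by rewrite -/c nth_default // mem_head.
by apply: (@mem_nth _ z c).
Qed.

(** Otherwise a shortest path from [x] to [y] through [A], closed up by [b], would be an induced
    cycle with at least four vertices, because [b] has no neighbour in [A]. *)
Lemma chordal_apex A x y b : chordal G -> gverts G = setT ->
  x \notin A -> y \notin A -> x != y ->
  (exists2 x1, x1 \in A & e x x1) -> (exists2 y1, y1 \in A & e y y1) ->
  {in A &, forall u v, connect (inner A) u v} ->
  b \notin A -> {in A, forall u, ~~ e b u} -> e b x -> e b y -> e x y.
Proof.
move=> chG hG xA yA xy xx1 yy1 conA bA nbA bx bY; apply/contraT => nxy.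
have [p [p0 pA uq step chord]] := shortest_path xA yA xy xx1 yy1 conA nxy.
move: uq step chord; set q := x :: rcons p y => uq step chord.
have szq : size q = (size p).+2 by rewrite /= size_rcons.
have uc : uniq (b :: q).
  rewrite cons_uniq uq andbT inE mem_rcons inE !negb_or.
  rewrite (adj_neq bx) (adj_neq bY) /=.
  by apply: contra bA => /(allP pA).
have nthq j : j < size q -> nth b (b :: q) j.+1 = nth x q j.
  by move=> jq; apply: set_nth_default.
have nthk : nth b (b :: q) (size q).+1 = b by rewrite nth_default.
have lastq : nth x q (size p).+1 = y by rewrite /= nth_rcons ltnn eqxx.
have p1 : 0 < size p by case: (p) p0.
have Cc : is_cycle (induced G [set z in b :: q]).
  have szc : size (b :: q) = (size p).+3 by rewrite /= size_rcons.
  apply: induced_is_cycle; rewrite ?szc //.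
    move=> [_|j jk]; first exact: bx.
    rewrite nthq ?szq //; move: jk; rewrite ltnS leq_eqVlt => /predU1P[[->]|jk].
      by rewrite -szq nthk lastq adj_sym.
    by rewrite nthq ?szq //; apply: step.
  move=> i [//|j] /andP[ij jk]; rewrite nthq ?szq //.
  case: i ij => [_|i ij]; last first.
    rewrite nthq ?szq //; last by lia.
    by move=> /chord ->; [left | lia].
  case: j jk => [_ _|j jk eb]; first by left.
  move: jk; rewrite !ltnS leq_eqVlt => /predU1P[->|jk]; first by right.
  move: eb; rewrite /= nth_rcons jk => eb.
  by have := nbA _ (allP pA _ (mem_nth x jk)); rewrite eb.
have := chG _ Cc; rewrite /induced_subgraph hG subsetT => /(_ (conj isT erefl)).
by rewrite /= cardsE (card_uniqP uc) /= size_rcons => -[E]; rewrite E in p1.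
Qed.

(** Dirac's argument: nonadjacent [a] and [b] in [S] are separated by a clique [X], and [S] splits
    into [A :|: X], which misses [b], and [S :\: A], which misses [a]. *)
Lemma chordal_weight S : gverts G = setT -> chordal G ->
  has_quadratic_weight e S.
Proof.
move=> hG chG; elim: {S}#|S|.+1 {-2}S (ltnSn #|S|) => // n IHn S.
rewrite ltnS => Sn.
have IH S' : S' \proper S -> has_quadratic_weight e S'.
  by move=> S'S; apply: IHn; apply: leq_trans (proper_card S'S) Sn.
have [cS|] := pselect (clique e S); first exact: clique_has_quadratic_weight.
move=> ncS; apply: contrapT => nP; apply: ncS => a b aS bS ab.
apply/contraT => nab; case: nP.
(* [A] is a maximal connected set containing [a] with no neighbour of [b]; by
   maximality all its outer neighbours [X] are adjacent to [b]. *)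
pose far A := [&& A \subset S, a \in A, [forall x in A, connect (inner A) a x]
  & [forall x in A, (x != b) && ~~ e x b]].
have far_a : far [set a].
  rewrite /far sub1set aS set11 /=.
  apply/andP; split; apply/forall_inP => x /set1P->.
    exact: connect0.
  by rewrite ab.
have [A /maxsetP[/and4P[AS aA conA bA] maxA] _] := maxset_exists far_a.
have {}conA x : x \in A -> connect (inner A) a x by move: x; exact/forall_inP.
have {}bA x : x \in A -> (x != b) && ~~ e x b by move: x; exact/forall_inP.
pose X := [set x in S | (x \notin A) && [exists y in A, e x y]].
have XN x : x \in X -> exists2 x1, x1 \in A & e x x1.
  by rewrite inE => /and3P[_ _ /exists_inP].
have Xb x : x \in X -> e b x.
  move=> xX; have [y yA xy] := XN x xX.
  move: (xX); rewrite inE => /and3P[xS xA _].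
  apply: contraT => nbx; case/negP: (xA).
  suff <- : x |: A = A by rewrite setU11.
  apply: maxA; last exact: subsetUr.
  rewrite /far subUset sub1set xS AS inE aA orbT /=.
  have mono u v : inner A u v -> connect (inner (x |: A)) u v.
    by move=> /and3P[uv uA vA]; apply: connect1; rewrite /= uv !inE uA vA !orbT.
  have con u : u \in A -> connect (inner (x |: A)) a u.
    by move=> /conA; apply: connect_sub.
  apply/andP; split; apply/forall_inP => u /setU1P[->|uA]; last exact: bA.
  - apply: connect_trans (con y yA) (connect1 _).
    by rewrite /= adj_sym xy !inE yA eqxx orbT.
  - exact: con.
  - rewrite adj_sym nbx andbT; apply: contraTneq xy => ->.
    by rewrite adj_sym; have /andP[] := bA y yA.
have conA2 : {in A &, forall u v, connect (inner A) u v}.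
  move=> u v uA vA; apply: connect_trans (conA v vA).
  by rewrite inner_sym conA.
have cX : clique e X.
  move=> x y xX yX xy; apply: (@chordal_apex A x y b) => //; auto.
  - by move: xX; rewrite inE => /and3P[].
  - by move: yX; rewrite inE => /and3P[].
  - by apply/negP => /bA; rewrite eqxx.
  - by move=> u /bA/andP[_]; rewrite adj_sym.
have XS x : (x \in X) ==> (x \in S) && (x \notin A).
  by apply/implyP; rewrite inE => /and3P[-> ->].
have AS' x := introT implyP (subsetP AS x).
have KE : (A :|: X) :&: (S :\: A) = X.
  apply/setP => x; have := XS x; have := AS' x; rewrite !in_setI !in_setU !in_setD.
  by case: (x \in X); case: (x \in A); case: (x \in S).
have -> : S = (A :|: X) :|: (S :\: A).
  apply/setP => x; have := XS x; have := AS' x; rewrite !in_setU !in_setD.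
  by case: (x \in X); case: (x \in A); case: (x \in S).
apply: clique_sum_has_quadratic_weight; first exact: adj_sym.
- by rewrite KE.
- move=> x y; have := XS x; rewrite !in_setU !in_setD negb_and negbK => Xx xAX xA.
  have {Xx xAX} {}xA : x \in A.
    by move: Xx xAX xA; case: (x \in X); case: (x \in A); case: (x \in S).
  move=> /andP[yA yS] /norP[_ yX]; apply: contra yX => xy.
  by rewrite inE yS yA; apply/exists_inP; exists x; rewrite // adj_sym.
- apply: IH; apply/properP; split.
    by apply/subsetP => x; have := XS x; have := AS' x; rewrite in_setU;
      case: (x \in X); case: (x \in A); case: (x \in S).
  exists b => //; rewrite in_setU negb_or; apply/andP; split.
    by apply/negP => /bA; rewrite eqxx.
  by apply/negP => /Xb /adj_neq; rewrite eqxx.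
- apply: IH; apply/properP; split; first exact: subsetDl.
  by exists a; rewrite // in_setD aA.
Qed.

End Chordal.

(** * Initial ideals *)

Lemma ideal_generated_trans (A : comNzRingType) (S1 S2 : A -> Prop) (x : A) :
  (forall g, S1 g -> exists2 c, S2 c & exists b, g = (b * c)%R) ->
  ideal_generated S1 x -> ideal_generated S2 x.
Proof.
move=> S12 [k [c [g [gS ->]]]].
have h i : exists cb, S2 cb.1 /\ g i = (cb.2 * cb.1)%R.
  by have [d dS [b ->]] := S12 _ (gS i); exists (d, b).
have [f fP] := choice h.
exists k, (fun i => c i * (f i).2)%R, (fun i => (f i).1).
split=> [i|]; first by have [] := fP i.
by apply: eq_bigr => i _; have [_ ->] := fP i; rewrite mulrA.
Qed.

(** * Fibers of the toric map on monomials *)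

Section Toric.
Context (K : fieldType) (n m : nat) (a : 'I_m -> 'rV[int]_n).
Variable W : 'I_m -> {set 'I_n}.
Hypothesis aW : forall i j, a i 0%R j = Posz (j \in W i).
Implicit Types (u v : 'X_{1..m}).

(** The exponent of the [x]-variables in the image of the monomial [u]; that of [t] is [mdeg u]. *)
Definition incidence u : 'X_{1..n} :=
  [multinom \sum_(i < m) u i * (j \in W i) | j < n].

Lemma mmap1_toric u :
  mmap1 (fun i => (laurent_monomial K (a i))%:P * 'X)%R u =
  ((FracField.tofrac ('X_[incidence u] : {mpoly K[n]}))%:P * 'X^(mdeg u))%R.
Proof.
have laurentE i : laurent_monomial K (a i) =
    FracField.tofrac (\prod_(j < n) ('X_j : {mpoly K[n]}) ^+ (j \in W i))%R.
  rewrite /laurent_monomial rmorph_prod; apply: eq_bigr => j _.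
  by rewrite aW rmorphXn -exprnP.
have -> : ('X_[incidence u] : {mpoly K[n]})%R =
    (\prod_(i < m) (\prod_(j < n) ('X_j : {mpoly K[n]}) ^+ (j \in W i)) ^+ u i)%R.
  under eq_bigr do rewrite -prodrXl.
  rewrite exchange_big mpolyXE_id; apply: eq_bigr => j _; rewrite mnmE -prodrXr.
  by apply: eq_bigr => i _; rewrite -exprM mulnC.
rewrite rmorph_prod rmorph_prod mdegE -prodrXr -big_split; apply: eq_bigr => i _.
by rewrite laurentE exprMn !rmorphXn.
Qed.

Lemma toric_mapE (p : {mpoly K[m]}) : toric_map a p =
  (\sum_(u <- msupp p)
    (FracField.tofrac (p@_u *: 'X_[incidence u]))%:P * 'X^(mdeg u))%R.
Proof.
rewrite /toric_map /mmap; apply: eq_bigr => u _.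
rewrite mmap1_toric -mul_mpolyC tofracM polyCM; exact: mulrA.
Qed.

(** Monomials of different fibers have different images, so comparing coefficients, first in [t] and
    then in the [x]-variables, isolates one fiber. *)
Lemma toric_ideal_fiber (p : {mpoly K[m]}) u : toric_ideal K a p ->
  (\sum_(v <- msupp p | (mdeg v == mdeg u) && (incidence v == incidence u)) p@_v
    = 0)%R.
Proof.
rewrite /toric_ideal toric_mapE.
move=> /(congr1 (fun q : {poly {fraction {mpoly K[n]}}} => q`_(mdeg u)))%R.
rewrite coef0 coef_sum (eq_bigr (fun v => FracField.tofrac
  (if mdeg v == mdeg u then p@_v *: 'X_[incidence v] else 0)))%R; last first.
  move=> v _; rewrite coefCM coefXn [mdeg u == _]eq_sym.
  by case: eqP => _; rewrite ?mulr1 ?mulr0 ?rmorph0.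
rewrite -rmorph_sum /= => /eqP; rewrite tofrac_eq0 => /eqP.
move=> /(congr1 (fun q : {mpoly K[n]} => q@_(incidence u)))%R.
rewrite mcoeff0 raddf_sum /= => E; rewrite -[RHS]E big_mkcond /=.
apply: eq_bigr => v _; case: (mdeg v == mdeg u) => /=; last by rewrite mcoeff0.
by rewrite mcoeffZ mcoeffX; case: eqP; rewrite ?mulr1 ?mulr0.
Qed.

Lemma toric_binomial u v : mdeg u = mdeg v -> incidence u = incidence v ->
  toric_ideal K a ('X_[u] - 'X_[v])%R.
Proof.
move=> E1 E2; rewrite /toric_ideal.
have -> : toric_map a ('X_[u] - 'X_[v])%R =
  mmap (polyC \o (@FracField.tofrac {mpoly K[n]} \o @mpolyC n K))
       (fun i => (laurent_monomial K (a i))%:P * 'X)%R ('X_[u] - 'X_[v])%R by [].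
by rewrite raddfB /= !mmapX !mmap1_toric E1 E2 subrr.
Qed.

End Toric.

(** * Bad pairs, standard monomials and the initial ideal *)

Section InitialIdeal.
Context (K : fieldType) (n m : nat) (a : 'I_m -> 'rV[int]_n) (e : rel 'I_n).
Variables (W : 'I_m -> {set 'I_n}) (w : {set 'I_n} -> nat).
Hypothesis aW : forall i j, a i 0%R j = Posz (j \in W i).
Hypothesis W_inj : injective W.
Hypothesis W_stab : forall i, stab e (W i).
Hypothesis stab_W : forall U, stab e U -> exists i, W i = U.
Hypothesis Hw : quadratic_weight e setT w.
Implicit Types (u v : 'X_{1..m}).

Let C := \sum_(i < m) w (W i).

(* The summands [C - w] are nonnegative, and on monomials of the same degree
   comparing their sums is comparing the sums of [w] in reverse. *)
Definition mweight u := \sum_(i < m) u i * (C - w (W i)).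

(** A better pair has smaller [mweight], so in the binomial of a bad pair and a better one the bad
    pair leads. *)
Definition weight_order : rel 'X_{1..m} := fun u v =>
  (mweight u < mweight v) || (mweight u == mweight v) && (u <= v)%O.

Lemma mweightD u v : mweight (u + v)%MM = mweight u + mweight v.
Proof.
by rewrite /mweight -big_split /=; apply: eq_bigr => i _; rewrite mnmDE mulnDl.
Qed.

Lemma mweight1 i : mweight U_(i)%MM = C - w (W i).
Proof.
rewrite /mweight (bigD1 i) //= mnm1E eqxx mul1n big1 ?addn0 // => j ji.
by rewrite mnm1E eq_sym (negPf ji).
Qed.

Lemma weight_orderP : monomial_order weight_order.
Proof.
rewrite /weight_order; split.
- by move=> u; rewrite eqxx lexx orbT.
- move=> u v; case: (ltngtP (mweight u) (mweight v)) => //= _.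
  exact: le_anti.
- move=> v u t; case: (ltngtP (mweight u) (mweight v)) => //= [uv _|-> uv].
    by case: ltngtP => //= [vt|<-] _; rewrite ?uv // (ltn_trans uv vt).
  by case: ltngtP => //= _; exact: le_trans.
- by move=> u v; case: ltngtP => //= _; exact: le_total.
- move=> u; rewrite le0x andbT orbC -leq_eqVlt.
  by rewrite {1}/mweight big1 // => i _; rewrite mnm0E.
- by move=> u v t; rewrite !mweightD ltn_add2r eqn_add2r lemc_add2l.
Qed.

Definition same_fiber u v :=
  mdeg u = mdeg v /\ incidence W u = incidence W v.

Lemma incidenceD u v : incidence W (u + v)%MM = (incidence W u + incidence W v)%MM.
Proof.
apply/mnmP => j; rewrite mnmDE !mnmE -big_split /=; apply: eq_bigr => i _.
by rewrite mnmDE mulnDl.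
Qed.

Lemma incidence1 i j : incidence W U_(i)%MM j = (j \in W i).
Proof.
rewrite mnmE (bigD1 i) //= mnm1E eqxx mul1n big1 ?addn0 // => l li.
by rewrite mnm1E eq_sym (negPf li).
Qed.

Lemma same_fiberD u v t : same_fiber u v -> same_fiber (u + t)%MM (v + t)%MM.
Proof. by move=> [E1 E2]; rewrite /same_fiber !mdegD !incidenceD E1 E2. Qed.

Definition bad u := exists i j,
  [/\ i != j, ~ good e w (W i) (W j) & u = (U_(i) + U_(j))%MM].

Lemma bad_squarefree u : bad u -> squarefree_quadratic u.
Proof.
move=> [i [j [ij _ ->]]]; split; first by rewrite mdegD !mdeg1.
move=> l; rewrite mnmDE !mnm1E.
have [il|] := eqVneq i l; have [jl|] //= := eqVneq j l.
by move: ij; rewrite il jl eqxx.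
Qed.

Lemma bad_reduce u : bad u -> exists2 v, same_fiber v u & mweight v < mweight u.
Proof.
move=> [i [j [_ bij ->]]].
have [U [U' [su' sv' H lt]]] : exists U U', [/\ stab e U, stab e U',
    same_sum [:: W i; W j] [:: U; U'] & w (W i) + w (W j) < w U + w U'].
  apply: contrapT => none; apply: bij => U U' su' sv' H.
  by rewrite leqNgt; apply/negP => lt; apply: none; exists U, U'.
have [i' Ei] := stab_W su'; have [j' Ej] := stab_W sv'; subst U U'.
exists (U_(i') + U_(j'))%MM.
  split; first by rewrite !mdegD !mdeg1.
  by apply/mnmP => l; rewrite !incidenceD !mnmDE !incidence1 (mem_same_sum l H).
rewrite !mweightD !mweight1.
(* [C] bounds every weight, so the truncated differences are true ones. *)
have leC l : w (W l) <= C by rewrite /C (bigD1 l) //= leq_addr.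
have := leC i; have := leC j; have := leC i'; have := leC j'; lia.
Qed.

Definition standard u := forall v, bad v -> ~~ (v <= u)%MM.

(** Replacing a bad divisor by a better pair stays in the fiber and lowers [mweight], so the process
    ends; any actual step makes the drop strict. *)
Lemma standard_exists u : exists v, [/\ same_fiber v u, standard v &
  v = u \/ mweight v < mweight u].
Proof.
elim: {u}(mweight u).+1 {-2}u (ltnSn (mweight u)) => // k IHk u.
rewrite ltnS => uk; have [su|nsu] := pselect (standard u).
  by exists u; split=> //; left.
have [b [bb bu]] : exists b, bad b /\ (b <= u)%MM.
  apply: contrapT => none; apply: nsu => v bv; apply/negP => vu; apply: none.
  by exists v.
have [v fv wv] := bad_reduce bb.
have Eu : u = (b + (u - b))%MM by rewrite addmC submK.
have wt : mweight (v + (u - b))%MM < mweight u.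
  by rewrite [in ltnRHS]Eu !mweightD ltn_add2r.
have [t [[f1 f2] st wt']] := IHk _ (leq_trans wt uk).
have [g1 g2] := same_fiberD (u - b)%MM fv; rewrite -Eu in g1 g2.
exists t; split=> //; first by split; [rewrite f1 g1|rewrite f2 g2].
right; case: wt' => [->//|lt]; exact: ltn_trans lt wt.
Qed.

Definition monomial_family u : seq {set 'I_n} :=
  flatten [seq nseq (u i) (W i) | i <- index_enum 'I_m].

Lemma count_monomial_family u (P : pred {set 'I_n}) :
  count P (monomial_family u) = \sum_(i < m) u i * P (W i).
Proof.
rewrite count_flatten sumnE !big_map; apply: eq_bigr => i _.
by rewrite count_nseq mulnC.
Qed.

Lemma mem_monomial_family u U :
  U \in monomial_family u -> exists2 i, 0 < u i & U = W i.
Proof.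
by move=> /flatten_mapP[i _]; rewrite mem_nseq => /andP[ui /eqP ->]; exists i.
Qed.

Lemma good_refl (v : {set 'I_n}) : good e w v v.
Proof.
move=> u' v' _ _ H; have E x := mem_same_sum x H.
suff [-> ->] : u' = v /\ v' = v by [].
by split; apply/setP => x; have := E x; case: (x \in v); case: (x \in u');
  case: (x \in v').
Qed.

Lemma standard_good u : standard u -> good_family e setT w (monomial_family u).
Proof.
move=> su; split=> [_ /mem_monomial_family[i _ ->]|]; first by rewrite subsetT.
move=> _ _ /mem_monomial_family[i ui ->] /mem_monomial_family[j uj ->].
have [->|ij] := eqVneq i j; first exact: good_refl.
apply: contrapT => nij; have /su/negP : bad (U_(i) + U_(j))%MM by exists i, j.
apply; apply/mnm_lepP => l; rewrite mnmDE !mnm1E.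
have [<-|_] := eqVneq i l; last by case: eqP => [<-|].
by rewrite eq_sym (negPf ij).
Qed.

(** The families of sets of both monomials are good, so [Hw] identifies them as multisets, and
    [W_inj] reads the exponents off as multiplicities. *)
Lemma standard_unique u v : standard u -> standard v -> same_fiber u v -> u = v.
Proof.
move=> su sv [E1 E2].
have /permP p : perm_eq (monomial_family u) (monomial_family v).
  apply: Hw; [exact: standard_good..| |].
    have E (t : 'X_{1..m}) : size (monomial_family t) = mdeg t.
      rewrite -count_predT count_monomial_family mdegE.
      by apply: eq_bigr => i _; rewrite muln1.
    by rewrite !E.
  move=> x; rewrite !count_monomial_family.
  by have /mnmP/(_ x) := E2; rewrite !mnmE.
apply/mnmP => i; have := p (pred1 (W i)); rewrite !count_monomial_family.
have E (t : 'X_{1..m}) : \sum_(j < m) t j * pred1 (W i) (W j) = t i.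
  rewrite (bigD1 i) //= eqxx muln1 big1 ?addn0 // => j ji.
  by rewrite (inj_eq W_inj) (negPf ji) muln0.
by rewrite !E.
Qed.

Lemma bad_initial u : bad u ->
  exists2 p, toric_ideal K a p & initial_monomial weight_order p u.
Proof.
move=> /bad_reduce[v [f1 f2] wv]; exists ('X_[u] - 'X_[v])%R.
  exact: toric_binomial aW _ _ (esym f1) (esym f2).
have uv : v != u by apply: contraTneq wv => ->; rewrite ltnn.
split.
  by rewrite mcoeff_msupp mcoeffB !mcoeffX eqxx (negPf uv) subr0 oner_neq0.
move=> t /msuppB_le; rewrite !msuppX mem_cat !inE => /orP[/eqP->|/eqP->].
  exact: mo_refl weight_orderP _.
by rewrite /weight_order wv.
Qed.

(** If [u] were standard, the vanishing coefficient sum over its fiber would yield another monomial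
    [v] of [p] there. Reducing [v] ends at the unique standard monomial [u] with a strict drop of
    [mweight], so [v] would exceed the initial monomial. *)
Lemma initial_bad p u : toric_ideal K a p -> initial_monomial weight_order p u ->
  exists2 v, bad v & (v <= u)%MM.
Proof.
move=> pI [up umax]; apply: contrapT => none.
have su : standard u by move=> v bv; apply/negP => vu; apply: none; exists v.
have [v [vp vu fv]] : exists v, [/\ v \in msupp p, v != u & same_fiber v u].
  apply: contrapT => nov; have := toric_ideal_fiber aW u pI.
  rewrite big_mkcond (bigD1_seq u) ?msupp_uniq //= !eqxx big_seq_cond big1 ?addr0.
    by move/eqP; rewrite mcoeff_eq0 up.
  move=> v /andP[vp vu]; case: ifP => // /andP[/eqP f1 /eqP f2].
  by case: nov; exists v.
have [t [[f1 f2] st tv]] := standard_exists v.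
have Etu : t = u.
  by case: fv => g1 g2; apply: standard_unique => //; split; rewrite ?f1 ?f2.
case: tv => [tv|]; first by move: vu; rewrite -tv Etu eqxx.
rewrite Etu => lt; have := umax v vp.
by rewrite /weight_order ltnNge ltnW //= gtn_eqF.
Qed.

Lemma toric_squarefree_quadratic :
  has_squarefree_quadratic_initial_ideal (toric_ideal K a).
Proof.
exists weight_order; split; first exact: weight_orderP.
exists bad; split; first exact: bad_squarefree.
move=> p; split; apply: ideal_generated_trans.
  move=> _ [u [q qI uq] ->]; have [v bv vu] := initial_bad qI uq.
  exists ('X_[v])%R; first by exists v.
  by exists ('X_[(u - v)%MM])%R; rewrite -mpolyXD submK.
move=> _ [u bu ->]; exists ('X_[u])%R; last by exists 1%R; rewrite mul1r.
by exists u => //; exact: bad_initial.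
Qed.

End InitialIdeal.

(** * Lattice points *)

Section LatticePoints.
Context (R : realType) (n : nat).
Local Open Scope ring_scope.

Lemma rhoE (U : {set 'I_n}) j : rho R U 0 j = (j \in U)%:R.
Proof.
rewrite /rho summxE; have [jU|jU] := boolP (j \in U).
  rewrite (bigD1 j) //= mxE !eqxx big1 ?addr0 // => i /andP[_ ij].
  by rewrite mxE eqxx eq_sym (negPf ij).
rewrite big1 // => i iU; rewrite mxE eqxx; case: eqP => // ji.
by move: jU; rewrite ji iU.
Qed.

Lemma rho_intr (U : {set 'I_n}) :
  map_mx intr (\row_j (j \in U)%:R : 'rV[int]_n) = rho R U.
Proof.
by apply/rowP => j; rewrite !mxE rhoE; case: (j \in U).
Qed.

(** The integral points of the hull have entries [0] or [1]. Both values are extreme, so such a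
    point agrees in each coordinate with any [p i] of nonzero coefficient. *)
Lemma stable_set_polytope_lattice (G : graph 'I_n) (z : 'rV[int]_n) :
  stable_set_polytope R G (map_mx intr z) <->
  exists2 U, stable G U & z = \row_j (j \in U)%:R.
Proof.
split=> [[k [p [w [pS w0 w1 zE]]]]|[U sU ->]]; last first.
  exists 1%N, (fun=> rho R U), (fun=> 1); split=> //; first by move=> _; exists U.
    by rewrite big_ord1.
  by rewrite big_ord1 scale1r rho_intr.
have [U UP] := choice (fun i => let: ex_intro2 U sU E := pS i in
  ex_intro (fun U => stable G U /\ p i = rho R U) U (conj sU E)).
have le1 (b : bool) : b%:R <= 1 :> R by case: b; rewrite ?lexx ?ler01.
have zjE j : (z 0 j)%:~R = \sum_i w i * (j \in U i)%:R.
  move/rowP/(_ j): zE; rewrite mxE summxE => ->; apply: eq_bigr => i _.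
  by rewrite mxE; have [_ ->] := UP i; rewrite rhoE.
have zj_ge0 j : 0 <= z 0 j.
  by rewrite -(ler0z R) zjE; apply: sumr_ge0 => i _; rewrite mulr_ge0 ?w0.
have zj_le1 j : z 0 j <= 1.
  rewrite -(lerz1 R) zjE -[leRHS]w1; apply: ler_sum => i _.
  rewrite -[leRHS]mulr1; apply: ler_wpM2l; [exact: w0 | exact: le1].
have [i wi] : exists i, w i != 0.
  apply: contrapT => none; move/eqP: w1; rewrite big1 ?(eq_sym 0) ?oner_eq0 //.
  by move=> i _; apply/eqP; apply/contraT => wi; case: none; exists i.
exists (U i); first by have [] := UP i.
apply/rowP => j; rewrite mxE.
have [z0|z1] : z 0 j = 0 \/ z 0 j = 1.
  have := zj_ge0 j; have := zj_le1 j; case: (z 0 j) => // [[|[|q]]] //; auto.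
- have /eqP := zjE j; rewrite z0 eq_sym psumr_eq0; last first.
    by move=> l _; rewrite mulr_ge0 ?w0.
  move=> /allP/(_ i (mem_index_enum _)) /=; rewrite mulf_eq0 (negPf wi) /=.
  by case: (j \in U i); rewrite ?oner_eq0.
- have /eqP : \sum_i w i * (1 - (j \in U i)%:R) = 0.
    under eq_bigr do rewrite mulrBr mulr1.
    by rewrite sumrB w1 -zjE z1 subrr.
  rewrite psumr_eq0; last first.
    by move=> l _; apply: mulr_ge0; [exact: w0 | rewrite subr_ge0; exact: le1].
  move=> /allP/(_ i (mem_index_enum _)) /=; rewrite mulf_eq0 (negPf wi) /= z1.
  by case: (j \in U i); rewrite // subr0 oner_eq0.
Qed.

End LatticePoints.

Lemma stable_stab (n : nat) (G : graph 'I_n) U : gverts G = setT ->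
  stable G U = stab (adj G) U.
Proof.
move=> hG; rewrite /stable hG subsetT /=.
apply/forall_inP/stabP => [H x y xU yU|H x xU].
  have [->|xy] := eqVneq x y; first by apply/negP => /adj_neq; rewrite eqxx.
  by have /forall_inP/(_ y yU)/implyP/(_ xy) := H x xU.
by apply/forall_inP => y yU; apply/implyP => _; exact: H.
Qed.

Theorem proposition1p4 (R : realType) (K : fieldType) (n : nat)
    (G : graph 'I_n) (hG : gverts G = [set: 'I_n])
    (hGcr : chordal G \/ ring_graph G)
    (m : nat) (a : 'I_m -> 'rV[int]_n)
    (ha : lattice_points (stable_set_polytope R G) a) :
  has_squarefree_quadratic_initial_ideal (toric_ideal K a).
Proof.
have [w Hw] : has_quadratic_weight (adj G) setT.
  by case: hGcr => [/chordal_weight|/ring_graph_weight]; apply.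
have [a_inj aP] := ha.
have aU i : exists U, stab (adj G) U /\ a i = (\row_j (j \in U)%:R)%R.
  have /stable_set_polytope_lattice[U] : stable_set_polytope R G (map_mx intr (a i)).
    by apply/aP; exists i.
  by rewrite stable_stab // => sU E; exists U.
have [W WP] := choice aU.
apply: (@toric_squarefree_quadratic K n m a (adj G) W w) => //.
- by move=> i j; have [_ ->] := WP i; rewrite mxE; case: (j \in W i).
- move=> i j Wij; apply: a_inj.
  by have [_ ->] := WP i; have [_ ->] := WP j; rewrite Wij.
- by move=> i; have [] := WP i.
- move=> U sU; have [|i ai] := (aP (\row_j (j \in U)%:R)%R).2.
    by apply/stable_set_polytope_lattice; exists U => //; rewrite stable_stab.
  exists i; apply/setP => j; have [_] := WP i; rewrite ai => /rowP/(_ j).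
  by rewrite !mxE; case: (j \in U); case: (j \in W i).
Qed.
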